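(* Let $d\ge 2$, $a>0$, $b>0$, $h\in\mathbb{R}$, and let $\mathbf e=(e_x)_{x\in\mathbb{Z}^d}$ be an i.i.d. family of real random variables with $\mathbb{E}(e_x)=0$, $\mathrm{Var}(e_x)=1$ and $\mathbb{E}(e^{b e_x+h})<\infty$. Then the limit $$f^{\mathbf q}(\mathbf e):=\lim_{\Lambda\uparrow\mathbb{Z}^d} f^{\mathbf q}_\Lambda(\mathbf e)\in\mathbb{R}$$ of the finite-volume quenched free energies exists almost surely and in $L^2$, and does not depend on the sequence $\Lambda\uparrow\mathbb{Z}^d$ provided that $|\partial\Lambda|/|\Lambda|\to 0$. Moreover, $f^{\mathbf q}(\mathbf e)$ is deterministic, i.e. $f^{\mathbf q}(\mathbf e)=\mathbb{E}(f^{\mathbf q}(\mathbf e))$ almost surely.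
   Context: For a finite set $\Lambda\subset\mathbb{Z}^d$ and $\varphi\in\mathbb{R}^{\mathbb{Z}^d}$, let $$\mathcal H_\Lambda(\varphi)=\frac1{4d}\sum_{\{x,y\}\cap\Lambda\neq\varnothing,\ x\sim y}(\varphi_x-\varphi_y)^2,$$ where the sum is over nearest-neighbour edges $\{x,y\}$ of $\mathbb{Z}^d$ with at least one endpoint in $\Lambda$. The partition function (with zero boundary conditions and inverse temperature $1$) is $$Z_\Lambda^{\mathbf e}=\int \exp\Big(-\mathcal H_\Lambda(\varphi)+\sum_{x\in\Lambda}(b e_x+h)\mathbf 1_{[\varphi_x\in[-a,a]]}\Big)\prod_{x\in\Lambda}d\varphi_x\prod_{y\in\Lambda^c}\delta_0(d\varphi_y).$$ $Z_\Lambda^0$ denotes the partition function of the model with no potential (the Gaussian free field), i.e. the same integral with the sum $\sum_{x\in\Lambda}(b e_x+h)\mathbf 1_{[\varphi_x\in[-a,a]]}$ replaced by $0$. The quenched free energy per site in $\Lambda$ is $$f^{\mathbf q}_\Lambda(\mathbf e)=|\Lambda|^{-1}\log\big(Z_\Lambda^{\mathbf e}/Z_\Lambda^0\big).$$ $\mathbb{E}$ and $\mathrm{Var}$ are with respect to the law of the environment $\mathbf e$. $\Lambda\uparrow\mathbb{Z}^d$ means along an increasing sequence of finite sets whose union is $\mathbb{Z}^d$; $\partial\Lambda$ is the set of sites outside $\Lambda$ having a nearest neighbour in $\Lambda$. *)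

(* Defs.v *)
From mathcomp Require Import all_boot all_order all_algebra.
From mathcomp Require Import finmap.
From mathcomp Require Import all_classical all_reals all_analysis.

Set Implicit Arguments.
Unset Strict Implicit.
Unset Printing Implicit Defensive.

Import Order.TTheory GRing.Theory Num.Theory.
Import numFieldNormedType.Exports.

Local Open Scope classical_set_scope.
Local Open Scope ring_scope.

Notation site d := 'rV[int]_d.

Section lattice.
Context {d : nat}.
Implicit Types (x : site d) (L : {fset site d}).

Definition basis_vec (i : 'I_d) : site d := delta_mx 0 i.

Definition neighbours x : {fset site d} :=
  ([fset (x + basis_vec i)%R | i in 'I_d] `|`
   [fset (x - basis_vec i)%R | i in 'I_d])%fset.

Definition boundary L : {fset site d} :=
  ((\bigcup_(x <- L) neighbours x) `\` L)%fset.

(* Every nearest-neighbour edge is {x, x + basis_vec i} for exactly one pair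
   (x, i); for fixed i, this is the set of the base points x of the edges that
   have at least one endpoint in L. *)
Definition edges_touching L (i : 'I_d) : {fset site d} :=
  (L `|` [fset (y - basis_vec i)%R | y in L])%fset.

Definition exhausting_sequence (L : nat -> {fset site d}) : Prop :=
  (forall n, (L n `<=` L n.+1)%fset) /\ (forall x, exists n, x \in L n).

Definition vanishing_boundary (R : realType) (L : nat -> {fset site d}) : Prop :=
  (#|` boundary (L n)|%:R / #|` L n|%:R : R) @[n --> \oo] --> (0 : R).

End lattice.

Section model.
Context {R : realType} {d : nat}.
Implicit Types (L : {fset site d}) (phi env : site d -> R).

Definition hamiltonian L phi : R :=
  (4 * d)%:R^-1 *
  \sum_(i < d) \sum_(x <- edges_touching L i) (phi (x + basis_vec i) - phi x) ^+ 2.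

(* Iterated Lebesgue integral of F over the coordinates listed in s, the other
   coordinates being frozen to those of phi. *)
Fixpoint field_integral (s : seq (site d)) (F : (site d -> R) -> \bar R) phi
    : \bar R :=
  if s is x :: s' then
    (\int[@lebesgue_measure R]_t field_integral s' F [eta phi with x |-> t])%E
  else F phi.

(* The frozen configuration 0 accounts for the factors delta_0 outside L; the
   integrands are nonnegative, so the order of integration is immaterial. *)
Definition partition_function L (U : (site d -> R) -> R) : \bar R :=
  field_integral L (fun phi => (expR (- hamiltonian L phi + U phi))%:E) (fun=> 0).

Definition pinning_potential (a b h : R) env L phi : R :=
  \sum_(x <- L) (b * env x + h) * \1_`[- a, a] (phi x).

Definition quenched_free_energy (a b h : R) L env : R :=
  #|` L|%:R^-1 *
  ln (fine (partition_function L (pinning_potential a b h env L)) /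
      fine (partition_function L (fun=> 0))).

End model.

Definition iid {dO} {Omega : measurableType dO} {R : realType}
    (P : probability Omega R) {I : choiceType} (X : I -> {RV P >-> R}) : Prop :=
  (forall i j (B : set R), measurable B -> P (X i @^-1` B) = P (X j @^-1` B)) /\
  (forall (J : {fset I}) (B : I -> set R), (forall i, measurable (B i)) ->
     P (\bigcap_(i in [set` J]) X i @^-1` B i) =
     (\prod_(i <- J) P (X i @^-1` B i))%E).

(* Main.v *)
(** Write the partition function with site potentials [V] as an integral against
    even one-site measures with ferromagnetic couplings. Integrating two copies of
    the field and changing the signs of their sum and of their difference site by
    site (Ginibre) gives the second Griffiths inequality, which says that
    [log Z_L] is a supermodular function of [L], for every realization of the
    environment. Adding [sum_(x in L) (|V x| + constant)] makes it nonnegative and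
    increasing; call the result [M_L].

    The mean [E M_L] is supermodular, translation invariant and at most linear in
    the volume. Adding the sites of [L] in lexicographic order, each increment is
    at most the supremum [c] of the increments over finite subsets of the past of a
    site, and it is almost [c] away from the boundary of [L]; hence
    [E M_L / |L|] tends to [c] when [|boundary L| / |L|] tends to [0].

    [M_L] is Lipschitz in each of the independent variables [e_x], so its variance
    is [O(|L|)] (Efron-Stein), which gives convergence in [L^2]. Almost sure
    convergence holds along [|L| ~ k^2], and monotonicity of [M_L] fills the gaps.
    The free energy is a combination of functionals of this kind, for the pinned
    model, for the free field and for the correction term. *)

From HB Require Import structures.
Require Import Defs.
From mathcomp Require Import all_boot all_order all_algebra.
From mathcomp Require Import finmap.
From mathcomp Require Import all_classical all_reals all_analysis.
From mathcomp Require Import measurable_realfun ring lra zify.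

Set Implicit Arguments.
Unset Strict Implicit.
Unset Printing Implicit Defensive.

Import Order.TTheory GRing.Theory Num.Theory.
Import numFieldNormedType.Exports.

Local Open Scope classical_set_scope.
Local Open Scope ring_scope.

(** * Iterated integrals *)

(** The volumes form an arbitrary increasing sequence with small boundary, not boxes, so ergodic
    theorems for regular shapes do not apply directly. The proof therefore rests on inequalities
    valid for all finite sets. With zero boundary values every site of [L] lies on [2 * d] of the
    counted edges, also near the boundary. Hence the diagonal part of the Hamiltonian is
    [phi x ^+ 2 / 2] per site whatever [L] is, and the cross terms are ferromagnetic with coupling
    [1 / (2 * d)]. Enlarging the volume only adds sites and turns couplings on, which is the
    situation of a Griffiths inequality. The interval [[- a, a]] is symmetric, so the one-site
    densities are even for a potential of either sign; this is why a random pinning does no harm.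
    The limiting constant is built from the mean functional alone, before any sequence is chosen.
    This gives independence of the sequence, and a constant limit is deterministic. *)

(** The integral of a nonnegative function is a supremum over the simple functions below it, so
    monotonicity holds without measurability. *)
Lemma ge0_le_integralT d (T : measurableType d) (R : realType)
    (mu : {measure set T -> \bar R}) (f g : T -> \bar R) :
  (forall t, 0 <= f t)%E -> (forall t, f t <= g t)%E ->
  (\int[mu]_t f t <= \int[mu]_t g t)%E.
Proof.
move=> f0 fg; have g0 t : (0 <= g t)%E by exact: le_trans (f0 t) (fg t).
rewrite !ge0_integralTE//; apply: le_ereal_sup => _ [h hf <-].
by exists h => // t; exact: le_trans (hf t) (fg t).
Qed.

Section iterated_integral.
Context {dT : measure_display} {T : measurableType dT} {R : realType} {I : eqType}.
Variable mu : {sigma_finite_measure set T -> \bar R}.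
Implicit Types (s : seq I) (phi psi : I -> T) (F G : (I -> T) -> \bar R).
Local Open Scope ereal_scope.

Definition update phi (x : I) (t : T) : I -> T := [eta phi with x |-> t].

(** Same recursion as [field_integral], for any index type and sigma-finite measure: it serves for
    Lebesgue measure on one or two copies of the field and for the law of the environment. *)
Fixpoint iterint s F phi : \bar R :=
  if s is x :: s' then \int[mu]_t iterint s' F (update phi x t) else F phi.

Lemma updateE phi x t y : update phi x t y = if y == x then t else phi y.
Proof. by []. Qed.

Lemma updateC phi x y t u : x != y ->
  update (update phi x t) y u = update (update phi y u) x t.
Proof.
move=> xy; apply/funext => z; rewrite !updateE.
by case: (eqVneq z y) => // ->; rewrite eq_sym (negbTE xy).
Qed.

Lemma update_idem phi x t u : update (update phi x t) x u = update phi x u.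
Proof. by apply/funext => z; rewrite !updateE; case: eqP. Qed.

Definition agree_off s phi psi := forall x, x \notin s -> psi x = phi x.

Lemma iterint_le_off s F G phi :
  (forall psi, 0 <= F psi) -> (forall psi, agree_off s phi psi -> F psi <= G psi) ->
  iterint s F phi <= iterint s G phi.
Proof.
move=> F0; elim: s phi => [|x s IH] phi FG /=; first exact: FG.
apply: ge0_le_integralT => t.
  by elim: s (update _ _ _) {IH FG} => //= y s IH psi; exact: integral_ge0.
apply: IH => psi psiE; apply: FG => y; rewrite inE negb_or => /andP[yx ys].
by rewrite psiE// updateE (negbTE yx).
Qed.

Lemma iterint_ge0 s F phi : (forall psi, 0 <= F psi) -> 0 <= iterint s F phi.
Proof.
by move=> F0; elim: s phi => //= x s IH phi; exact: integral_ge0.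
Qed.

Lemma eq_iterint_off s F G phi :
  (forall psi, agree_off s phi psi -> F psi = G psi) ->
  iterint s F phi = iterint s G phi.
Proof.
elim: s phi => [|x s IH] phi FG /=; first exact: FG.
apply: eq_integral => t _; apply: IH => psi psiE; apply: FG => y.
by rewrite inE negb_or => /andP[yx ys]; rewrite psiE// updateE (negbTE yx).
Qed.

Lemma iterint_cat s1 s2 F phi :
  iterint (s1 ++ s2) F phi = iterint s1 (iterint s2 F) phi.
Proof.
by elim: s1 phi => //= x s1 IH phi; apply: eq_integral => t _; rewrite IH.
Qed.

Lemma iterint_agree s F phi psi :
  (forall x, x \notin s -> phi x = psi x) -> iterint s F phi = iterint s F psi.
Proof.
elim: s phi psi => [|x s IH] phi psi E /=.
  by congr F; apply/funext => x; exact: E.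
apply: eq_integral => t _; apply: IH => y ys; rewrite !updateE.
by case: eqVneq => // yx; apply: E; rewrite inE negb_or yx.
Qed.

(* Fields are not given a sigma-algebra: a functional is measurable when it is so
   along every family of fields with measurable coordinates. *)
Definition param_measurable d0 (P : measurableType d0) (F : P -> (I -> T) -> \bar R) :=
  forall d1 (S : measurableType d1) (p : S -> P) (g : S -> I -> T),
    measurable_fun [set: S] p -> (forall x, measurable_fun [set: S] (g ^~ x)) ->
    measurable_fun [set: S] (fun u => F (p u) (g u)).

Definition coord_measurable F := forall d1 (S : measurableType d1) (g : S -> I -> T),
  (forall x, measurable_fun [set: S] (g ^~ x)) ->
  measurable_fun [set: S] (fun u => F (g u)).

Lemma measurable_update d1 (S : measurableType d1) (g : S -> I -> T) (h : S -> T) x :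
  (forall y, measurable_fun [set: S] (g ^~ y)) -> measurable_fun [set: S] h ->
  forall y, measurable_fun [set: S] (fun u => update (g u) x (h u) y).
Proof.
move=> mg mh y; under eq_fun do rewrite updateE.
by case: eqP => _; [exact: mh|exact: mg].
Qed.

(** Integrating a coordinate moves it into the parameter: the inner integral must be measurable on
    [S * T] before Tonelli applies. Hence the quantification over all source spaces in
    [param_measurable]. *)
Lemma param_measurable_iterint d0 (P : measurableType d0) s (F : P -> (I -> T) -> \bar R) :
  (forall p phi, 0 <= F p phi) -> param_measurable F ->
  param_measurable (fun p => iterint s (F p)).
Proof.
move=> F0 mF; elim: s => [//|x s IH] d1 S p g mp mg /=.
apply: (measurable_fun_fubini_tonelli_F
  (fun z : S * T => iterint s (F (p z.1)) (update (g z.1) x z.2))) => /=.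
- apply: (IH _ _ (fun z : S * T => p z.1) (fun z => update (g z.1) x z.2)).
  + exact: (measurableT_comp mp measurable_fst).
  + apply: measurable_update => [y|]; last exact: measurable_snd.
    exact: (measurableT_comp (mg y) measurable_fst).
- by move=> z; exact: iterint_ge0.
Qed.

Lemma coord_measurable_iterint s F : (forall phi, 0 <= F phi) ->
  coord_measurable F -> coord_measurable (iterint s F).
Proof.
move=> F0 mF d1 S g mg.
apply: (@param_measurable_iterint _ S s (fun=> F) _ _ _ S id g) => //.
by move=> d2 S2 p g2 _ mg2; exact: mF.
Qed.

Lemma measurable_iterint_update s F phi x : (forall phi, 0 <= F phi) ->
  coord_measurable F -> measurable_fun [set: T] (fun t => iterint s F (update phi x t)).
Proof.
move=> F0 mF; apply: (@coord_measurable_iterint s _ F0 mF _ T (update phi x)) => y.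
under eq_fun do rewrite updateE.
by case: eqP => _; [exact: measurable_id|exact: measurable_cst].
Qed.

Lemma iterintZl s (k : \bar R) F phi : 0 <= k -> (forall psi, 0 <= F psi) ->
  coord_measurable F ->
  iterint s (fun psi => k * F psi) phi = k * iterint s F phi.
Proof.
move=> k0 F0 mF; elim: s phi => //= x s IH phi.
under eq_integral do rewrite IH.
rewrite ge0_integralZl//; first exact: measurable_iterint_update.
by move=> t _; exact: iterint_ge0.
Qed.

Lemma iterintD s F G phi : (forall psi, 0 <= F psi) -> (forall psi, 0 <= G psi) ->
  coord_measurable F -> coord_measurable G ->
  iterint s (fun psi => F psi + G psi) phi = iterint s F phi + iterint s G phi.
Proof.
move=> F0 G0 mF mG; elim: s phi => //= x s IH phi.
under eq_integral do rewrite IH.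
rewrite ge0_integralD//; try by move=> t _; exact: iterint_ge0.
- exact: measurable_iterint_update.
- exact: measurable_iterint_update.
Qed.

Lemma iterint_factor s F G phi : (forall psi, 0 <= F psi) -> (forall psi, 0 <= G psi) ->
  coord_measurable F -> (forall psi, agree_off s phi psi -> G psi = G phi) ->
  iterint s (fun psi => G psi * F psi) phi = G phi * iterint s F phi.
Proof.
move=> F0 G0 mF GE; rewrite -iterintZl//.
by apply: eq_iterint_off => psi /GE ->.
Qed.

Lemma iterint_swap x y s F phi : x != y -> (forall psi, 0 <= F psi) ->
  coord_measurable F -> iterint (x :: y :: s) F phi = iterint (y :: x :: s) F phi.
Proof.
move=> xy F0 mF /=.
pose H (z : T * T) := iterint s F (update (update phi x z.1) y z.2).
have mH : measurable_fun [set: T * T] H.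
  apply: (@coord_measurable_iterint s _ F0 mF _ (T * T)%type
    (fun z => update (update phi x z.1) y z.2)).
  apply: measurable_update; last exact: measurable_snd.
  apply: measurable_update; last exact: measurable_fst.
  by move=> z; exact: measurable_cst.
have H0 z : 0 <= H z by exact: iterint_ge0.
transitivity (\int[mu]_u \int[mu]_t H (t, u)); first exact: fubini_tonelli mH H0.
by apply: eq_integral => u _; apply: eq_integral => t _; rewrite /H updateC.
Qed.

Lemma perm_iterint s1 s2 F phi : uniq s1 -> perm_eq s1 s2 ->
  (forall psi, 0 <= F psi) -> coord_measurable F ->
  iterint s1 F phi = iterint s2 F phi.
Proof.
move=> + + F0 mF; elim: s1 s2 phi => [|x s1 IH] s2 phi; first by rewrite perm_sym => _ /perm_nilP ->.
move=> /= /andP[xs1 us1] s12.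
have : x \in s2 by rewrite -(perm_mem s12) mem_head.
move=> /splitPr s2E; case: s2E s12 => l r s12.
have s1E : perm_eq s1 (l ++ r).
  by rewrite -(perm_cons x) (perm_trans s12)// -(cat1s x r) perm_catCA.
have {xs1} : x \notin l by move: xs1; rewrite (perm_mem s1E) mem_cat negb_or => /andP[].
have -> : \int[mu]_t iterint s1 F (update phi x t) = iterint (x :: l ++ r) F phi.
  by apply: eq_integral => t _; exact: IH.
(* [x] travels through [l] to its place by adjacent swaps. *)
elim: l phi {s12 s1E} => // y l IHl phi; rewrite inE negb_or => /andP[xy xl].
rewrite -[(y :: l) ++ _]/(y :: l ++ _) iterint_swap//=.
by apply: eq_integral => t _; rewrite -IHl.
Qed.

End iterated_integral.

(** Transport along a map of fields that turns updating [x] into updating [tau x]. Translations,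
    permutations of coordinates, a sign change at another coordinate and the embedding of one copy
    into two are all of this form. *)
Lemma iterint_map {dT} {T : measurableType dT} {R : realType} {I J : eqType}
    (mu : {sigma_finite_measure set T -> \bar R}) (tau : I -> J) (s : seq I)
    (F : (J -> T) -> \bar R) (Phi : (I -> T) -> J -> T) :
  (forall psi x t, x \in s -> Phi (update psi x t) = update (Phi psi) (tau x) t) ->
  forall psi, iterint mu (map tau s) F (Phi psi) = iterint mu s (F \o Phi) psi.
Proof.
elim: s => [//|x s IH] PhiE psi /=.
apply: eq_integral => t _; rewrite -PhiE ?mem_head// IH// => psi' y u ys.
by apply: PhiE; rewrite inE ys orbT.
Qed.

(** * The Griffiths-Ginibre inequality *)

Section sign_flips.
Context {R : realType} {S : eqType}.
Implicit Types (Phi : bool * S -> R) (i j : bool * S) (Q : (bool * S -> R) -> R).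

(* A configuration [Phi] on [bool * S] is a pair of fields on [S]; coordinate
   [(true, x)] of the rotated system is their sum at [x], and [(false, x)] their
   difference. *)
Definition rotated i Phi : R :=
  Phi (true, i.2) + (if i.1 then 1 else -1) * Phi (false, i.2).

(** Negates the rotated coordinate [i] and no other: exchanging the copies at a site negates their
    difference, exchanging them with both signs changed negates their sum. *)
Definition flip i Phi : bool * S -> R := fun y =>
  if y.2 == i.2 then (if i.1 then -1 else 1) * Phi (~~ y.1, y.2) else Phi y.

Definition monomial (m : seq (bool * S)) Phi : R := \prod_(i <- m) rotated i Phi.

Definition flip_invariant Q := forall i Phi, Q (flip i Phi) = Q Phi.

(** A cone closed under products. The monomials may only use coordinates of [q], because
    [sign_average] only averages over the signs of these. *)
Inductive sign_positive (q : seq (bool * S)) : ((bool * S -> R) -> R) -> Prop :=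
| Sp_term c m : (forall Phi, 0 <= c Phi) -> flip_invariant c -> {subset m <= q} ->
    sign_positive q (fun Phi => c Phi * monomial m Phi)
| Sp_add Q1 Q2 : sign_positive q Q1 -> sign_positive q Q2 ->
    sign_positive q (fun Phi => Q1 Phi + Q2 Phi).

Fixpoint sign_average (q : seq (bool * S)) Q Phi : R :=
  if q is i :: q' then
    2^-1 * (sign_average q' Q Phi + sign_average q' Q (flip i Phi))
  else Q Phi.

Lemma rotated_flip i j Phi : rotated j (flip i Phi) = (-1) ^+ (j == i) * rotated j Phi.
Proof.
case: i j => [bi xi] [bj xj]; rewrite /rotated /flip /= xpair_eqE.
by case: (eqVneq xj xi) => [->|_]; case: bi; case: bj; rewrite /= ?expr0 ?expr1; ring.
Qed.

Lemma monomial_flip i m Phi :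
  monomial m (flip i Phi) = (-1) ^+ (count_mem i m) * monomial m Phi.
Proof.
elim: m => [|j m IH]; first by rewrite /monomial !big_nil expr0 mul1r.
by rewrite /monomial !big_cons -!/(monomial _ _) IH rotated_flip /= exprD mulrACA.
Qed.

Lemma sign_averageD q Q1 Q2 Phi : sign_average q (fun Phi => Q1 Phi + Q2 Phi) Phi =
  sign_average q Q1 Phi + sign_average q Q2 Phi.
Proof. by elim: q Phi => //= i q IH Phi; rewrite !IH -mulrDr addrACA. Qed.

Lemma sign_averageB q Q1 Q2 Phi : sign_average q (fun Phi => Q1 Phi - Q2 Phi) Phi =
  sign_average q Q1 Phi - sign_average q Q2 Phi.
Proof. by elim: q Phi => //= i q IH Phi; rewrite !IH -mulrBr opprD addrACA. Qed.

Lemma sign_average_term q c m Phi : flip_invariant c ->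
  sign_average q (fun Phi => c Phi * monomial m Phi) Phi =
  (\prod_(i <- q) (2^-1 * (1 + (-1) ^+ (count_mem i m)))) * (c Phi * monomial m Phi).
Proof.
move=> cinv; elim: q Phi => [|i q IH] Phi /=; first by rewrite big_nil mul1r.
by rewrite !IH big_cons cinv monomial_flip; ring.
Qed.

(** Averaging multiplies a term by [(1 + (-1) ^+ n) / 2] for each exponent [n] at a coordinate of
    [q]. One odd exponent kills the term; otherwise, since [m] lies in [q], the monomial is a
    product of even powers. *)
Lemma sign_average_ge0 q Q : sign_positive q Q -> forall Phi, 0 <= sign_average q Q Phi.
Proof.
elim => [c m c0 cinv mq|Q1 Q2 _ IH1 _ IH2] Phi; last first.
  by rewrite sign_averageD addr_ge0.
rewrite sign_average_term//.
have [ev|/allPn[i iq odd_i]] := boolP (all (fun i => ~~ odd (count_mem i m)) q).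
  rewrite mulr_ge0//; last rewrite mulr_ge0//.
    rewrite big_seq prodr_ge0// => i /(allP ev) ei.
    by rewrite -signr_odd (negbTE ei) expr0 mulr_ge0.
  rewrite /monomial -big_undup_iterop_count/= big_seq prodr_ge0// => i.
  rewrite mem_undup => /mq /(allP ev) ei; rewrite -[iterop _ _ _ _]/(_ ^+ _).
  by rewrite exprn_even_ge0.
by rewrite (big_rem i)//= -signr_odd (negbNE odd_i) expr1 subrr mulr0 !mul0r.
Qed.

Lemma sign_positive_eq q Q1 Q2 : Q1 =1 Q2 -> sign_positive q Q1 -> sign_positive q Q2.
Proof. by move=> /funext ->. Qed.

Lemma sign_positive_even q c : (forall Phi, 0 <= c Phi) -> flip_invariant c ->
  sign_positive q c.
Proof.
move=> c0 cinv; apply: (sign_positive_eq _ (@Sp_term q c [::] c0 cinv _)) => //.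
by move=> Phi; rewrite /monomial big_nil mulr1.
Qed.

Lemma sign_positive_mul q Q1 Q2 : sign_positive q Q1 -> sign_positive q Q2 ->
  sign_positive q (fun Phi => Q1 Phi * Q2 Phi).
Proof.
move=> + P2; elim => [c m c0 cinv mq|P P' _ IH _ IH']; last first.
  by apply: sign_positive_eq (Sp_add IH IH') => Phi; rewrite mulrDl.
elim: P2 => [c' m' c0' cinv' mq'|P P' _ IH _ IH']; last first.
  by apply: sign_positive_eq (Sp_add IH IH') => Phi; rewrite mulrDr.
apply: (sign_positive_eq _ (@Sp_term q (fun Phi => c Phi * c' Phi) (m ++ m') _ _ _)).
- by move=> Phi; rewrite /monomial big_cat/= mulrACA.
- by move=> Phi; exact: mulr_ge0.
- by move=> i Phi; rewrite cinv cinv'.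
- by move=> i; rewrite mem_cat => /orP[/mq|/mq'].
Qed.

Lemma monomial_flip_sign i m Phi :
  monomial m (flip i Phi) = monomial m Phi \/ monomial m (flip i Phi) = - monomial m Phi.
Proof.
rewrite monomial_flip -signr_odd; case: odd.
  by right; rewrite expr1 mulN1r.
by left; rewrite expr0 mul1r.
Qed.

Section exponential.
Variables (K : R) (K0 : 0 <= K) (q : seq (bool * S)).
Implicit Types (m : seq (bool * S)) (ts : seq (seq (bool * S))).

Definition poly_energy ts Phi : R :=
  K * \sum_(m <- ts) monomial m Phi.

Lemma poly_energy_nil Phi : poly_energy [::] Phi = 0.
Proof. by rewrite /poly_energy big_nil mulr0. Qed.

Lemma poly_energy_cons m ts Phi :
  poly_energy (m :: ts) Phi = K * monomial m Phi + poly_energy ts Phi.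
Proof. by rewrite /poly_energy big_cons mulrDr. Qed.

Let z m Phi : R := K * monomial m Phi.

Let z_flip m i Phi : z m (flip i Phi) = z m Phi \/ z m (flip i Phi) = - z m Phi.
Proof.
rewrite /z; case: (monomial_flip_sign i m Phi) => ->; [by left|right].
by rewrite mulrN.
Qed.

Lemma sign_positive_sinh1 m : {subset m <= q} ->
  sign_positive q (fun Phi => expR (K * monomial m Phi) - expR (- (K * monomial m Phi))).
Proof.
move=> mq; have [K_0|Kn0] := eqVneq K 0.
  apply: (@sign_positive_eq _ (fun=> 0)); last exact: sign_positive_even.
  by move=> Phi; rewrite K_0 mul0r oppr0 subrr.
(* With [z = K * monomial m Phi], the difference is the odd factor [z] times the even nonnegative
   function [(expR z - expR (- z)) / z]. A flip changes [z] at most by its sign, so [c] is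
   invariant; at [z = 0] both the difference and the quotient are 0. *)
pose c Phi := K * ((expR (z m Phi) - expR (- z m Phi)) / z m Phi).
apply: (sign_positive_eq _ (@Sp_term q c m _ _ mq)).
- move=> Phi; rewrite /c -/(z m Phi) /z.
  have [->|n0] := eqVneq (monomial m Phi) 0.
    by rewrite !mulr0 oppr0 expR0 subrr.
  by field; apply/andP.
- move=> Phi; rewrite mulr_ge0//.
  have [z0|z0|z0] := ltrgtP 0 (z m Phi); last by rewrite -[in X in _ / X]z0 invr0 mulr0.
  + by rewrite divr_ge0 ?(ltW z0)// subr_ge0 ler_expR; lra.
  + by rewrite -mulrNN -invrN divr_ge0//; [rewrite opprB subr_ge0 ler_expR|]; lra.
- move=> i Phi; rewrite /c; case: (z_flip m i Phi) => ->//.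
  by rewrite opprK invrN mulrN -mulNr opprB.
Qed.

Lemma sign_positive_cosh1 m :
  sign_positive q (fun Phi => expR (K * monomial m Phi) + expR (- (K * monomial m Phi))).
Proof.
apply: sign_positive_even => [Phi|i Phi]; first by rewrite addr_ge0 ?expR_ge0.
by rewrite -!/(z _ _); case: (z_flip m i Phi) => -> //; rewrite opprK addrC.
Qed.

Lemma sign_positive_const (c : R) : 0 <= c -> sign_positive q (fun=> c).
Proof. by move=> c0; exact: sign_positive_even. Qed.

(** Addition formulas of the hyperbolic sine and cosine; each formula involves both functions, so
    the induction is simultaneous. The functions are doubled, whence the factors [2^-1]. *)
Lemma sign_positive_sinh_cosh ts : (forall m, m \in ts -> {subset m <= q}) ->
  sign_positive q (fun Phi => expR (poly_energy ts Phi) - expR (- poly_energy ts Phi)) /\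
  sign_positive q (fun Phi => expR (poly_energy ts Phi) + expR (- poly_energy ts Phi)).
Proof.
elim: ts => [_|m ts IH tsq].
  split.
    apply: (@sign_positive_eq _ (fun=> 0)); last exact: sign_positive_const.
    by move=> Phi; rewrite poly_energy_nil oppr0 expR0 subrr.
  apply: (@sign_positive_eq _ (fun=> 1 + 1)); last exact: sign_positive_const.
  by move=> Phi; rewrite poly_energy_nil oppr0 expR0.
have tsq' m' : m' \in ts -> {subset m' <= q}.
  by move=> m'ts; apply: tsq; rewrite inE m'ts orbT.
have [] := IH tsq'.
have sm := sign_positive_sinh1 (tsq m (mem_head _ _)).
have cm := sign_positive_cosh1 m.
have h2 : 0 <= 2^-1 :> R by [].
move=> sts cts; split.
  apply: (sign_positive_eq _ (sign_positive_mul (sign_positive_const h2)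
    (Sp_add (sign_positive_mul sm cts) (sign_positive_mul cm sts)))) => Phi.
  by rewrite poly_energy_cons opprD !expRD; field.
apply: (sign_positive_eq _ (sign_positive_mul (sign_positive_const h2)
  (Sp_add (sign_positive_mul sm sts) (sign_positive_mul cm cts)))) => Phi.
by rewrite poly_energy_cons opprD !expRD; field.
Qed.

Lemma sign_positive_sinh ts : (forall m, m \in ts -> {subset m <= q}) ->
  sign_positive q (fun Phi => expR (poly_energy ts Phi) - expR (- poly_energy ts Phi)).
Proof. by move=> /sign_positive_sinh_cosh[]. Qed.

Lemma sign_positive_exp ts : (forall m, m \in ts -> {subset m <= q}) ->
  sign_positive q (fun Phi => expR (poly_energy ts Phi)).
Proof.
move=> /sign_positive_sinh_cosh[sts cts]; have h2 : 0 <= 2^-1 :> R by [].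
apply: (sign_positive_eq _ (sign_positive_mul (sign_positive_const h2)
  (Sp_add sts cts))) => Phi; by field.
Qed.

(** [expR (x + y) - 1] is [(expR x - 1) * expR y + (expR y - 1)], and for one monomial [expR z - 1]
    is half the sum of the even part [expR z + expR (- z) - 2], a square over [expR z], and of the
    doubled hyperbolic sine. *)
Lemma sign_positive_expB1 ts : (forall m, m \in ts -> {subset m <= q}) ->
  sign_positive q (fun Phi => expR (poly_energy ts Phi) - 1).
Proof.
elim: ts => [_|m ts IH tsq].
  apply: (@sign_positive_eq _ (fun=> 0)); last exact: sign_positive_const.
  by move=> Phi; rewrite poly_energy_nil expR0 subrr.
have tsq' m' : m' \in ts -> {subset m' <= q}.
  by move=> m'ts; apply: tsq; rewrite inE m'ts orbT.
have mm : sign_positive q (fun Phi => expR (K * monomial m Phi) - 1).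
  have h2 : 0 <= 2^-1 :> R by [].
  have cm1 : sign_positive q (fun Phi => expR (K * monomial m Phi) +
      expR (- (K * monomial m Phi)) - 2).
    apply: sign_positive_even => [Phi|i Phi].
      have := expR_gt0 (K * monomial m Phi); rewrite expRN; set E := expR _ => E0.
      have -> : E + E^-1 - 2 = (E - 1) ^+ 2 / E by field; rewrite gt_eqF.
      by rewrite divr_ge0 ?sqr_ge0// ltW.
    rewrite -!/(z _ _); case: (z_flip m i Phi) => -> //.
    by rewrite opprK (addrC (expR _)).
  apply: (sign_positive_eq _ (sign_positive_mul (sign_positive_const h2)
    (Sp_add cm1 (sign_positive_sinh1 (tsq m (mem_head _ _)))))) => Phi.
  by field.
apply: (sign_positive_eq _ (Sp_add (sign_positive_mul mm (sign_positive_exp tsq'))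
  (IH tsq'))) => Phi.
by rewrite poly_energy_cons expRD; ring.
Qed.

End exponential.
End sign_flips.

Lemma ge0_integral_lebesgueN {R : realType} (h : measurableTypeR R -> \bar R) :
  measurable_fun [set: measurableTypeR R] h -> (forall t, 0 <= h t)%E ->
  (\int[@lebesgue_measure R]_t h (- t)%R = \int[@lebesgue_measure R]_t h t)%E.
Proof.
move=> mh h0.
have mN : measurable_fun [set: measurableTypeR R] (-%R : measurableTypeR R -> measurableTypeR R).
  exact: (@oppr_measurable R setT).
rewrite -[LHS](@ge0_integral_pushforward _ _ _ _ _ _ mN _ setT h)//.
by apply: eq_measure_integral => A mA _; exact: lebesgue_measureN.
Qed.

(** * Sign flips and two copies under the integral *)

Section lebesgue_iterated.
Context {R : realType}.
Local Notation RR := (measurableTypeR R).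
Local Notation leb := (@lebesgue_measure R).

Lemma iterint_neg {I : eqType} (s : seq I) (y : I) (F : (I -> RR) -> \bar R) phi :
  uniq s -> y \in s -> (forall psi, 0 <= F psi)%E -> coord_measurable F ->
  iterint leb s (fun psi => F (update psi y (- psi y)%R)) phi = iterint leb s F phi.
Proof.
move=> us ys F0 mF.
pose N (psi : I -> RR) : I -> RR := update psi y (- psi y)%R.
have mFN : coord_measurable (F \o N).
  move=> d1 S g mg; apply: mF; apply: measurable_update => //.
  by apply: (@measurableT_comp _ _ _ _ RR RR (-%R)) => //; exact: (@oppr_measurable R setT).
have sE := perm_to_rem ys.
rewrite !(@perm_iterint _ _ _ _ _ s (y :: rem y s))//=.
have yr : y \notin rem y s by rewrite mem_rem_uniqF.
rewrite -[RHS]ge0_integral_lebesgueN; last 2 first.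
- exact: measurable_iterint_update.
- by move=> t; exact: iterint_ge0.
apply: eq_integral => t _.
have NE psi x t' : x \in rem y s -> N (update psi x t') = update (N psi) (id x) t'.
  move=> xs; have xy : y == x = false by apply: contraNF yr => /eqP {1}->.
  apply/funext => z; rewrite /N !updateE xy.
  by case: (eqVneq z y) => [->|//]; rewrite xy.
rewrite -[LHS](iterint_map leb F NE) map_id; congr iterint.
by rewrite /N update_idem updateE eqxx.
Qed.

Lemma iterint_relabel {I : eqType} (s : seq I) (tau : I -> I) (F : (I -> RR) -> \bar R) phi :
  uniq s -> involutive tau -> (forall x, (tau x \in s) = (x \in s)) ->
  (forall x, x \notin s -> tau x = x) ->
  (forall psi, 0 <= F psi)%E -> coord_measurable F ->
  iterint leb s (fun psi => F (psi \o tau)) phi = iterint leb s F phi.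
Proof.
move=> us tauK taus taun F0 mF.
have E (psi : I -> RR) x t : x \in s -> update psi x t \o tau = update (psi \o tau) (tau x) t.
  by move=> _; apply/funext => z; rewrite /= !updateE (can2_eq tauK tauK).
rewrite -[LHS](iterint_map leb F E) -(@perm_iterint _ _ _ _ _ s)//.
  by apply: iterint_agree => x xs /=; rewrite taun.
apply: uniq_perm => // [|x]; first by rewrite map_inj_uniq//; exact: can_inj tauK.
by rewrite -[x in RHS]tauK mem_map ?taus//; exact: can_inj tauK.
Qed.

Context {S : eqType}.
Implicit Types (s : seq S) (Phi : bool * S -> RR).

Definition doubled s : seq (bool * S) :=
  [seq (true, x) | x <- s] ++ [seq (false, x) | x <- s].

Lemma mem_doubled s i : (i \in doubled s) = (i.2 \in s).
Proof.
case: i => b x; rewrite mem_cat; apply/orP/idP => /= [[]/mapP[y ys [_ ->]]//|xs].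
by case: b; [left|right]; exact: map_f.
Qed.

Lemma doubled_uniq s : uniq s -> uniq (doubled s).
Proof.
move=> us; rewrite cat_uniq !map_inj_uniq ?us//= ?andbT; try by move=> x y [].
by apply/hasPn => _ /mapP[x xs ->]; apply/negP => /mapP[].
Qed.

Lemma coord_measurable_flip i (F : (bool * S -> RR) -> \bar R) :
  coord_measurable F -> coord_measurable (fun Phi => F (flip i Phi)).
Proof.
move=> mF d1 T g mg; apply: mF => y; rewrite /flip; case: i => b x /=.
case: (y.2 == x); last exact: mg.
case: b; last by under eq_fun do rewrite mul1r; exact: mg.
under eq_fun do rewrite mulN1r.
by apply: (@measurableT_comp _ _ _ _ RR RR (-%R)) => //; exact: (@oppr_measurable R setT).
Qed.

(** The flip at [(false, x)] is an exchange of two coordinates; the flip at [(true, x)] combines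
    this exchange with two reflections. *)
Lemma iterint_flip s i (F : (bool * S -> RR) -> \bar R) Phi : uniq s -> i.2 \in s ->
  (forall psi, 0 <= F psi)%E -> coord_measurable F ->
  iterint leb (doubled s) (fun psi => F (flip i psi)) Phi = iterint leb (doubled s) F Phi.
Proof.
move=> us xs F0 mF; case: i xs => b x /= xs.
have ud := doubled_uniq us.
pose tau (y : bool * S) := if y.2 == x then (~~ y.1, y.2) else y.
have tauK : involutive tau.
  by move=> [c y]; rewrite /tau /=; case: (eqVneq y x) => [->|/negbTE yx] /=; rewrite ?eqxx ?negbK ?yx.
have swap (G : (bool * S -> RR) -> \bar R) : (forall psi, 0 <= G psi)%E ->
    coord_measurable G ->
    iterint leb (doubled s) (fun psi => G (psi \o tau)) Phi = iterint leb (doubled s) G Phi.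
  move=> G0 mG; apply: iterint_relabel => //.
    by move=> [c y]; rewrite !mem_doubled /tau /=; case: ifP.
  move=> [c y]; rewrite mem_doubled /tau /=; case: eqP => // -> .
  by rewrite xs.
pose neg c (psi : bool * S -> RR) : bool * S -> RR := update psi (c, x) (- psi (c, x))%R.
have mneg c (G : (bool * S -> RR) -> \bar R) : coord_measurable G ->
    coord_measurable (fun psi => G (neg c psi)).
  move=> mG d1 T g mg; apply: mG; apply: measurable_update => //.
  by apply: (@measurableT_comp _ _ _ _ RR RR (-%R)) => //; exact: (@oppr_measurable R setT).
case: b; last first.
  rewrite -[RHS]swap//; apply: eq_iterint_off => psi _; congr F.
  by apply/funext => -[c y]; rewrite /flip /tau /=; case: ifP => // _; rewrite mul1r.
rewrite -[RHS](@iterint_neg _ _ (true, x)) ?mem_doubled//.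
rewrite -[RHS](@iterint_neg _ _ (false, x)) ?mem_doubled//; last exact: (mneg true).
rewrite -[RHS]swap//; last exact: (mneg false _ (mneg true _ mF)).
apply: eq_iterint_off => psi _; congr F; apply/funext => -[c y].
rewrite /flip !updateE /= !xpair_eqE /tau /=.
by case: (eqVneq y x) => [->|yx]; case: c; rewrite /= ?andbF ?andbT ?eqxx ?mulN1r ?(negbTE yx).
Qed.

Lemma coord_measurable_sign_average q (Q : (bool * S -> RR) -> R) :
  coord_measurable (fun Phi => (Q Phi)%:E) ->
  coord_measurable (fun Phi => (sign_average q Q Phi)%:E).
Proof.
move=> mQ; elim: q => //= i q IH d1 T g mg; apply/measurable_EFinP.
apply: measurable_funM => //; apply: measurable_funD; apply/measurable_EFinP.
  exact: IH.
exact: (@coord_measurable_flip i _ IH).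
Qed.

Lemma sign_average_nonneg q (Q : (bool * S -> RR) -> R) Phi :
  (forall Psi, 0 <= Q Psi) -> 0 <= sign_average q Q Phi.
Proof.
by move=> Q0; elim: q Phi => //= i q IH Phi; rewrite mulr_ge0// addr_ge0.
Qed.

Lemma iterint_sign_average s q (Q : (bool * S -> RR) -> R) Phi : uniq s ->
  (forall i, i \in q -> i.2 \in s) -> (forall Psi, 0 <= Q Psi) ->
  coord_measurable (fun Phi => (Q Phi)%:E) ->
  iterint leb (doubled s) (fun Psi => (sign_average q Q Psi)%:E) Phi =
  iterint leb (doubled s) (fun Psi => (Q Psi)%:E) Phi.
Proof.
move=> us + Q0 mQ; elim: q => //= i q IH qs.
have mA := coord_measurable_sign_average q mQ.
have A0 Psi : (0 <= (sign_average q Q Psi)%:E)%E by rewrite lee_fin sign_average_nonneg.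
have AF0 Psi : (0 <= (sign_average q Q (flip i Psi))%:E)%E by exact: A0.
have mAF := coord_measurable_flip i mA.
transitivity (iterint leb (doubled s) (fun Psi : bool * S -> RR =>
    (2^-1)%:E * ((sign_average q Q Psi)%:E + (sign_average q Q (flip i Psi))%:E))%E Phi).
  by apply: eq_iterint_off => Psi _; rewrite -EFinD -EFinM.
rewrite iterintZl//; last 2 first.
- by move=> Psi; rewrite adde_ge0.
- by move=> d1 T g mg; apply: emeasurable_funD; [exact: mA|exact: mAF].
rewrite iterintD// (iterint_flip (F := fun Psi => (sign_average q Q Psi)%:E))//; last first.
  by apply: qs; rewrite mem_head.
rewrite IH => [|j jq]; last by apply: qs; rewrite inE jq orbT.
(* The integral may be infinite; averaging two equal values is harmless then too. *)
set X := iterint _ _ _ _; have : (0 <= X)%E by apply: iterint_ge0 => Psi; rewrite lee_fin.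
case: X => [x _| _|//]; last by rewrite addye// gt0_muley// lte_fin.
by rewrite -EFinD -EFinM; congr EFin; field.
Qed.

(* Ginibre: sign-flip averaging turns [sign_positive] into a pointwise inequality. *)
Lemma ginibre s q (Q1 Q2 : (bool * S -> RR) -> R) Phi : uniq s ->
  (forall i, i \in q -> i.2 \in s) ->
  (forall Psi, 0 <= Q1 Psi) -> (forall Psi, 0 <= Q2 Psi) ->
  coord_measurable (fun Phi => (Q1 Phi)%:E) -> coord_measurable (fun Phi => (Q2 Phi)%:E) ->
  sign_positive q (fun Psi => Q2 Psi - Q1 Psi) ->
  (iterint leb (doubled s) (fun Psi => (Q1 Psi)%:E) Phi <=
   iterint leb (doubled s) (fun Psi => (Q2 Psi)%:E) Phi)%E.
Proof.
move=> us qs Q10 Q20 mQ1 mQ2 Q12.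
rewrite -(iterint_sign_average _ us qs)// -(iterint_sign_average (Q := Q2) _ us qs)//.
apply: iterint_le_off => [Psi|Psi _]; first by rewrite lee_fin sign_average_nonneg.
by rewrite lee_fin -subr_ge0 -sign_averageB sign_average_ge0.
Qed.

Lemma iterint_doubled s (F G : (S -> RR) -> \bar R) Phi :
  (forall psi, 0 <= F psi)%E -> (forall psi, 0 <= G psi)%E ->
  coord_measurable F -> coord_measurable G ->
  iterint leb (doubled s)
    (fun Psi => F (fun x => Psi (true, x)) * G (fun x => Psi (false, x)))%E Phi =
  (iterint leb s F (fun x => Phi (true, x)) * iterint leb s G (fun x => Phi (false, x)))%E.
Proof.
move=> F0 G0 mF mG.
(* [half b psi Psi] overwrites copy [b] of [Psi] by [psi]; it turns an integral over one copy into
   an integral over [s]. *)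
pose half (b : bool) (psi : S -> RR) (Psi : bool * S -> RR) (y : bool * S) : RR :=
  if y.1 == b then psi y.2 else Psi y.
have half_map (b : bool) (H : (S -> RR) -> \bar R) (Psi : bool * S -> RR) :
    iterint leb [seq (b, x) | x <- s] (fun Psi : bool * S -> RR => H (fun x => Psi (b, x))) Psi =
    iterint leb s H (fun x => Psi (b, x)).
  have E (psi : S -> RR) x t : x \in s -> half b (update psi x t) Psi = update (half b psi Psi) (b, x) t.
    by move=> _; apply/funext => -[c y]; rewrite /half !updateE /= xpair_eqE; case: eqP.
  have -> : Psi = half b (fun x => Psi (b, x)) Psi.
    by apply/funext => -[c y]; rewrite /half /=; case: eqP => // ->.
  rewrite (iterint_map leb (fun Psi : bool * S -> RR => H (fun x => Psi (b, x))) E).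
  have -> : (fun x => half b (fun x0 => Psi (b, x0)) Psi (b, x)) = (fun x => Psi (b, x)).
    by apply/funext => x; rewrite /half /= eqxx.
  apply: eq_iterint_off => psi _ /=; congr H.
  by apply/funext => x; rewrite /half /= eqxx.
have mhalf (b : bool) (H : (S -> RR) -> \bar R) : coord_measurable H ->
    coord_measurable (fun Psi : bool * S -> RR => H (fun x => Psi (b, x))).
  by move=> mH d1 T g mg; apply: mH => x; exact: mg.
rewrite iterint_cat.
transitivity (iterint leb [seq (true, x) | x <- s] (fun Psi =>
    iterint leb s G (fun x => Phi (false, x)) * F (fun x => Psi (true, x)))%E Phi).
  apply: eq_iterint_off => Psi PsiE.
  rewrite iterint_factor//; last 2 first.
  - exact: (mhalf false).
  - move=> psi psiE; congr F; apply/funext => x; rewrite psiE//.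
    by apply/negP => /mapP[].
  rewrite half_map muleC; congr (_ * _)%E; congr iterint.
  by apply/funext => x; rewrite PsiE//; apply/negP => /mapP[].
rewrite iterintZl//; last 2 first.
- exact: iterint_ge0.
- exact: (mhalf true).
by rewrite half_map muleC.
Qed.

End lebesgue_iterated.

(** * The second Griffiths inequality for pair couplings *)

Section griffiths.
Context {R : realType} {S : eqType}.
Local Notation RR := (measurableTypeR R).
Local Notation leb := (@lebesgue_measure R).
Variables (s : seq S) (p : S -> R -> R) (J : R).
Hypotheses (us : uniq s) (J0 : 0 <= J) (p0 : forall x t, 0 <= p x t).
Hypothesis p_even : forall x t, p x (- t) = p x t.
Hypothesis mp : forall x, measurable_fun [set: R] (p x).
Implicit Types (l : seq (S * S)) (phi : S -> RR).

Definition weight phi : R := \prod_(x <- s) p x (phi x).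

Definition pair_energy l (phi : S -> R) : R := \sum_(e <- l) phi e.1 * phi e.2.

Definition spin_integral l phi : \bar R :=
  iterint leb s (fun psi => (weight psi * expR (J * pair_energy l psi))%:E) phi.

Lemma weight_ge0 phi : 0 <= weight phi. Proof. exact: prodr_ge0. Qed.

Lemma pair_energy_cat l1 l2 phi :
  pair_energy (l1 ++ l2) phi = pair_energy l1 phi + pair_energy l2 phi.
Proof. by rewrite /pair_energy big_cat. Qed.

Lemma coord_measurable_weight : coord_measurable (fun phi : S -> RR => (weight phi)%:E).
Proof.
move=> d1 T g mg; apply/measurable_EFinP; apply: measurable_prod => x _.
exact: (measurableT_comp (mp x) (mg x)).
Qed.

Lemma coord_measurable_expR_energy l :
  coord_measurable (fun phi : S -> RR => (expR (J * pair_energy l phi))%:E).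
Proof.
move=> d1 T g mg; apply/measurable_EFinP; apply: measurableT_comp => //.
apply: measurable_funM => //; apply: measurable_sum => e.
exact: measurable_funM (mg e.1) (mg e.2).
Qed.

Lemma coord_measurable_spin l :
  coord_measurable (fun phi : S -> RR => (weight phi * expR (J * pair_energy l phi))%:E).
Proof.
move=> d1 T g mg; apply/measurable_EFinP; apply: measurable_funM; apply/measurable_EFinP.
  exact: coord_measurable_weight.
exact: (@coord_measurable_expR_energy l).
Qed.

(** The factor [1 / 4]: each spin of the first copy is half the sum of its two rotated coordinates,
    and an edge multiplies two spins. *)
Let P := poly_energy (S := S) (J / 4).

(* Edges expanded in the rotated coordinates: the energy of the first field, and
   half the sum and half the difference of the energies of the two fields. *)
Let first_terms l := flatten [seq [:: [:: (true, e.1); (true, e.2)];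
  [:: (true, e.1); (false, e.2)]; [:: (false, e.1); (true, e.2)];
  [:: (false, e.1); (false, e.2)]] | e <- l].
Let even_terms l := flatten [seq [:: [:: (true, e.1); (true, e.2)];
  [:: (false, e.1); (false, e.2)]] | e <- l].
Let odd_terms l := flatten [seq [:: [:: (true, e.1); (false, e.2)];
  [:: (false, e.1); (true, e.2)]] | e <- l].

Let mono2 i j (Phi : bool * S -> RR) : monomial [:: i; j] Phi = rotated i Phi * rotated j Phi.
Proof. by rewrite /monomial !big_cons big_nil mulr1. Qed.

Let first_termsE l (Phi : bool * S -> RR) :
  P (first_terms l) Phi = J * pair_energy l (fun x => Phi (true, x)).
Proof.
elim: l => [|e l IH]; first by rewrite /pair_energy big_nil mulr0; exact: poly_energy_nil.
rewrite [first_terms _]/= /P !poly_energy_cons -/P IH !mono2 /rotated /= /pair_energy big_cons.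
by field.
Qed.

Let even_termsE l (Phi : bool * S -> RR) : P (even_terms l) Phi =
  J * (pair_energy l (fun x => Phi (true, x)) + pair_energy l (fun x => Phi (false, x))) / 2.
Proof.
elim: l => [|e l IH].
  by rewrite /pair_energy !big_nil addr0 mulr0 mul0r; exact: poly_energy_nil.
rewrite [even_terms _]/= /P !poly_energy_cons -/P IH !mono2 /rotated /= /pair_energy !big_cons.
by field.
Qed.

Let odd_termsE l (Phi : bool * S -> RR) : P (odd_terms l) Phi =
  J * (pair_energy l (fun x => Phi (true, x)) - pair_energy l (fun x => Phi (false, x))) / 2.
Proof.
elim: l => [|e l IH].
  by rewrite /pair_energy !big_nil subr0 mulr0 mul0r; exact: poly_energy_nil.
rewrite [odd_terms _]/= /P !poly_energy_cons -/P IH !mono2 /rotated /= /pair_energy !big_cons.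
by field.
Qed.

Let in_s l := forall e, e \in l -> (e.1 \in s) && (e.2 \in s).

Let terms_sub l : in_s l -> [/\ forall m, m \in first_terms l -> {subset m <= doubled s},
  forall m, m \in even_terms l -> {subset m <= doubled s} &
  forall m, m \in odd_terms l -> {subset m <= doubled s}].
Proof.
by move=> ls; split=> m /flattenP[? /mapP[e /ls/andP[e1 e2] ->]]; rewrite !inE;
  do ?[move=> /orP[|]]; move=> /eqP -> i; rewrite !inE mem_doubled => /orP[]/eqP ->.
Qed.

Lemma weight_flip_invariant : flip_invariant (fun Phi : bool * S -> R =>
  weight (fun x => Phi (true, x)) * weight (fun x => Phi (false, x))).
Proof.
move=> [b y] Phi; rewrite /weight -!big_split /=; apply: eq_bigr => x _.
rewrite /flip /=; case: eqP => // ->; rewrite mulrC.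
by case: b; rewrite ?mul1r ?mulN1r ?p_even.
Qed.

(** Each product becomes an integral over two copies, its left factor in the first copy. The two
    integrands share the weights, [l0] in both copies and [k] in the first. What remains is
    [expR (J * (c + x)) - expR (J * c')], where [c] and [c'] are the energies of [m] in the two
    copies and [x] that of [n] in the first. *)
Theorem griffiths l0 k m n phi : in_s (l0 ++ k ++ m ++ n) ->
  (spin_integral (l0 ++ k) phi * spin_integral (l0 ++ m) phi <=
   spin_integral (l0 ++ k ++ m ++ n) phi * spin_integral l0 phi)%E.
Proof.
move=> ls.
have [ls0 lsk lsm lsn] : [/\ in_s l0, in_s k, in_s m & in_s n].
  by split=> e el; apply: ls; rewrite !mem_cat el ?orbT.
pose Phi0 : bool * S -> RR := fun i => phi i.2.
pose f l (psi : S -> RR) := (weight psi * expR (J * pair_energy l psi))%:E.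
have f0 l psi : (0 <= f l psi)%E by rewrite lee_fin mulr_ge0 ?weight_ge0 ?expR_ge0.
have mf l : coord_measurable (f l) by exact: coord_measurable_spin.
have WW l1 l2 : (spin_integral l1 phi * spin_integral l2 phi = iterint leb (doubled s)
    (fun Psi => ((weight (fun x => Psi (true, x)) *
        expR (J * pair_energy l1 (fun x => Psi (true, x)))) *
      (weight (fun x => Psi (false, x)) *
        expR (J * pair_energy l2 (fun x => Psi (false, x)))))%:E) Phi0)%E.
  by rewrite -(@iterint_doubled _ _ s (f l1) (f l2) Phi0).
rewrite !WW; apply: (ginibre (q := doubled s)) => //.
- by move=> i; rewrite mem_doubled.
- by move=> Psi; rewrite mulr_ge0 ?mulr_ge0 ?weight_ge0 ?expR_ge0.
- by move=> Psi; rewrite mulr_ge0 ?mulr_ge0 ?weight_ge0 ?expR_ge0.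
- move=> d1 T g mg; apply/measurable_EFinP; apply: measurable_funM; apply/measurable_EFinP.
    exact: (mf _ _ _ (fun u x => g u (true, x))).
  exact: (mf _ _ _ (fun u x => g u (false, x))).
- move=> d1 T g mg; apply/measurable_EFinP; apply: measurable_funM; apply/measurable_EFinP.
    exact: (mf _ _ _ (fun u x => g u (true, x))).
  exact: (mf _ _ _ (fun u x => g u (false, x))).
have J4 : 0 <= J / 4 by rewrite divr_ge0.
have [_ e0 _] := terms_sub ls0; have [fk _ _] := terms_sub lsk.
have [fm em om] := terms_sub lsm; have [fn _ _] := terms_sub lsn.
have c0 (Phi : bool * S -> R) :
    0 <= weight (fun x => Phi (true, x)) * weight (fun x => Phi (false, x)).
  by rewrite mulr_ge0 ?weight_ge0.
have E0 := sign_positive_exp J4 e0; have Ek := sign_positive_exp J4 fk.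
have Em := sign_positive_exp J4 fm; have En := sign_positive_expB1 J4 fn.
have Em' := sign_positive_exp J4 em; have Om := sign_positive_sinh J4 om.
(* With [S = expR (J * (c + c') / 2)] and [D = expR (J * (c - c') / 2)], the remaining difference is
   [S * D * (expR (J * x) - 1) + S * (D - D^-1)]. [E0] occurs squared because [even_terms] carries
   half of the total energy of the two copies. *)
apply: (sign_positive_eq _ (sign_positive_mul
  (sign_positive_mul (sign_positive_even _ c0 weight_flip_invariant)
    (sign_positive_mul (sign_positive_mul E0 E0) Ek))
  (Sp_add (sign_positive_mul Em En) (sign_positive_mul Em' Om)))) => Psi.
rewrite -!/(P _ _) first_termsE !even_termsE odd_termsE !first_termsE.
set w := weight _; set w' := weight _.
rewrite !pair_energy_cat.
set t := fun x => Psi (true, x); set u := fun x => Psi (false, x).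
set a := pair_energy l0 t; set a' := pair_energy l0 u; set b := pair_energy k t.
set c := pair_energy m t; set c' := pair_energy m u; set x := pair_energy n t.
have -> : expR (J * c) = expR (J * (c + c') / 2) * expR (J * (c - c') / 2).
  by rewrite -expRD; congr expR; field.
have -> : w * expR (J * (a + (b + (c + x)))) * (w' * expR (J * a')) =
    w * w' * (expR (J * (a + a') / 2) * expR (J * (a + a') / 2) * expR (J * b) *
      (expR (J * (c + c') / 2) * expR (J * (c - c') / 2)) * expR (J * x)).
  by rewrite mulrACA -!expRD; congr (_ * expR _); field.
have -> : w * expR (J * (a + b)) * (w' * expR (J * (a' + c'))) =
    w * w' * (expR (J * (a + a') / 2) * expR (J * (a + a') / 2) * expR (J * b) *
      (expR (J * (c + c') / 2) * expR (- (J * (c - c') / 2)))).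
  by rewrite mulrACA -!expRD; congr (_ * expR _); field.
ring.
Qed.

End griffiths.

(** * The pinned partition function *)

Lemma integral_gaussian {R : realType} (m sigma : R) : sigma != 0 ->
  (\int[@lebesgue_measure R]_t (expR (- (t - m) ^+ 2 / (sigma ^+ 2 *+ 2)))%:E =
   ((normal_peak sigma)^-1)%:E)%E.
Proof.
move=> s0; have pk := normal_peak_gt0 s0.
have := integral_normal_pdf m sigma; rewrite normal_pdfE//.
under eq_integral do rewrite EFinM.
rewrite ge0_integralZl_EFin//; last 3 first.
- by move=> t _; rewrite lee_fin normal_fun_ge0.
- by apply/measurable_EFinP; exact: measurable_normal_fun.
- exact: ltW.
rewrite -[LHS]/((normal_peak sigma)%:E * \int[lebesgue_measure]_t (normal_fun m sigma t)%:E)%E.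
rewrite -/(normal_fun m sigma).
set X := integral _ _ _ => H.
have -> : X = (((normal_peak sigma)^-1)%:E * ((normal_peak sigma)%:E * X))%E.
  by rewrite muleA -EFinM mulVf ?mul1e// gt_eqF.
by rewrite H mule1.
Qed.

Section partition.
Context {R : realType} {d : nat}.
Hypothesis d0 : (0 < d)%N.
Variable a : R.
Local Notation RR := (measurableTypeR R).
Local Notation leb := (@lebesgue_measure R).
Implicit Types (L A B : {fset site d}) (V : site d -> R) (x : site d).

Lemma field_integralE (s : seq (site d)) (F : (site d -> R) -> \bar R) phi :
  field_integral s F phi = iterint leb s F phi.
Proof. by elim: s phi => //= x s IH phi; apply: eq_integral => t _; exact: IH. Qed.

(** Oriented by base points as in [edges_touching], so that each edge inside [L] is listed once. *)
Definition inner_edges L : seq (site d * site d) :=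
  [seq e <- [seq (x, x + basis_vec i) | i <- index_enum 'I_d, x <- L] | e.2 \in L].

Lemma sum_inner_edges L (Q : pred (site d * site d)) (f : site d * site d -> R) :
  \sum_(e <- inner_edges L | Q e) f e =
  \sum_(i < d) \sum_(x <- L | (x + basis_vec i \in L) && Q (x, x + basis_vec i))
    f (x, x + basis_vec i).
Proof.
rewrite big_filter_cond big_mkcond big_allpairs_dep.
by apply: eq_bigr => i _; rewrite [RHS]big_mkcond.
Qed.

(** For each direction, [phi x ^+ 2] with [x] in [L] occurs twice, at the two edges through [x];
    summed over [d] directions and divided by [4 * d] this is one half. The diagonal part thus does
    not feel the shape of [L], and all volumes share the same one-site densities. *)
Lemma hamiltonian_spin L (phi : site d -> R) : (forall x, x \notin L -> phi x = 0) ->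
  hamiltonian L phi =
  \sum_(x <- L) phi x ^+ 2 / 2 - (2 * d)%:R^-1 * pair_energy (inner_edges L) phi.
Proof.
move=> phi0; rewrite /pair_energy sum_inner_edges /hamiltonian.
have d0R : d%:R != 0 :> R by rewrite pnatr_eq0 -lt0n.
have step (i : 'I_d) : \sum_(x <- edges_touching L i) (phi (x + basis_vec i) - phi x) ^+ 2 =
    2 * \sum_(x <- L) phi x ^+ 2 -
    2 * \sum_(x <- L | (x + basis_vec i \in L) && true) phi x * phi (x + basis_vec i).
  have LE : (L `<=` edges_touching L i)%fset by exact: fsubsetUl.
  have LE' : ([fset (y - basis_vec i)%R | y in L] `<=` edges_touching L i)%fset.
    exact: fsubsetUr.
  transitivity (\sum_(x <- edges_touching L i) (phi (x + basis_vec i) ^+ 2 +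
      (phi x ^+ 2 - 2 * (phi x * phi (x + basis_vec i))))).
    by apply: eq_bigr => x _; ring.
  rewrite !big_split/= sumrN -mulr_sumr.
  have -> : \sum_(x <- edges_touching L i) phi (x + basis_vec i) ^+ 2 =
      \sum_(x <- L) phi x ^+ 2.
    rewrite -(big_fset_incl _ LE')/=; last first.
      move=> x _ xL; rewrite phi0 ?expr0n//; apply: contra xL => xL.
      by apply/imfsetP; exists (x + basis_vec i); rewrite ?addrK.
    rewrite big_imfset/=; last by move=> x y _ _ /addIr.
    by apply: eq_bigr => x _; rewrite subrK.
  rewrite -(big_fset_incl _ LE)/=; last by move=> x _ /phi0 ->; rewrite expr0n.
  rewrite -(big_fset_incl _ LE)/=; last by move=> x _ /phi0 ->; rewrite mul0r.
  have -> : \sum_(x <- L) phi x * phi (x + basis_vec i) =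
      \sum_(x <- L | (x + basis_vec i \in L) && true) phi x * phi (x + basis_vec i).
    rewrite [RHS]big_mkcond/=; apply: eq_bigr => x _; rewrite andbT.
    by case: ifPn => // /phi0 ->; rewrite mulr0.
  by ring.
rewrite (eq_bigr _ (fun i _ => step i)) big_split/= sumr_const card_ord sumrN -mulr_sumr.
rewrite -mulr_suml -mulr_natl !natrM.
set X := \sum_(_ <- _) _; set Y := \sum_(_ < _) _.
by field.
Qed.

Definition site_density (v t : R) : R := expR (- (t ^+ 2 / 2) + v * \1_`[- a, a] t).

Definition pinned_partition V L : \bar R :=
  partition_function L (fun phi => \sum_(x <- L) V x * \1_`[- a, a] (phi x)).

Lemma pinned_partition_spin V L : pinned_partition V L =
  spin_integral L (fun x => site_density (V x)) (2 * d)%:R^-1 (inner_edges L) (fun=> 0).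
Proof.
rewrite /pinned_partition /partition_function field_integralE.
apply: eq_iterint_off => psi psi0; congr EFin.
rewrite hamiltonian_spin// /weight /site_density -expR_sum -expRD; congr expR.
by rewrite big_split/= sumrN; ring.
Qed.

Lemma measurable_site_density v : measurable_fun [set: R] (site_density v).
Proof.
apply: measurableT_comp => //; apply: measurable_funD.
  by apply: measurableT_comp => //; apply: measurable_funM => //; exact: measurable_funX.
by apply: measurable_funM => //; exact: measurable_indic.
Qed.

Lemma site_density_ge0 v t : 0 <= site_density v t. Proof. exact: expR_ge0. Qed.

Lemma site_density_even v t : site_density v (- t) = site_density v t.
Proof.
rewrite /site_density sqrrN !indicE.
have -> // : (- t \in `[- a, a]%classic) = (t \in `[- a, a]%classic).
by apply/idP/idP; rewrite !inE/= !in_itv/= => /andP[t1 t2]; apply/andP; split; lra.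
Qed.

Lemma indic_norm_le (A : set R) (v t : R) : `|v * \1_A t| <= `|v|.
Proof.
by rewrite indicE; case: (t \in A); rewrite ?mulr1// mulr0 normr0.
Qed.

(** The integral of [expR (- t ^+ 2 / 2)], the square root of [2 * pi]. *)
Definition gauss_mass : R := (normal_peak (1 : R))^-1.

Lemma gauss_mass_gt0 : 0 < gauss_mass.
Proof. by rewrite invr_gt0 normal_peak_gt0 ?oner_eq0. Qed.

Definition site_mass v : R := fine (\int[leb]_t (site_density v t)%:E)%E.

Lemma site_density_bounds v t :
  expR (- `|v|) * expR (- (t - 0) ^+ 2 / (1 ^+ 2 *+ 2)) <= site_density v t <=
  expR `|v| * expR (- (t - 0) ^+ 2 / (1 ^+ 2 *+ 2)).
Proof.
rewrite -!expRD /site_density !ler_expR subr0 expr1n mulNr.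
have := indic_norm_le `[- a, a]%classic v t; rewrite ler_norml => /andP[h1 h2].
by apply/andP; split; lra.
Qed.

Lemma integral_gaussianZ (c : R) : 0 <= c ->
  (\int[leb]_t (c * expR (- (t - 0) ^+ 2 / (1 ^+ 2 *+ 2)))%:E = (c * gauss_mass)%:E)%E.
Proof.
move=> c0; under eq_integral do rewrite EFinM.
have mf : measurable_fun [set: R] (fun t : R => (expR (- (t - 0) ^+ 2 / (1 ^+ 2 *+ 2)))%:E).
  by apply/measurable_EFinP; exact: (measurable_normal_fun 0 1).
have f0 t : (0 <= (expR (- (t - 0) ^+ 2 / (1 ^+ 2 *+ 2)) : R)%:E)%E.
  by rewrite lee_fin expR_ge0.
by rewrite ge0_integralZl_EFin// integral_gaussian ?oner_eq0.
Qed.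

Lemma site_massE v : (\int[leb]_t (site_density v t)%:E = (site_mass v)%:E)%E.
Proof.
rewrite /site_mass fineK// ge0_fin_numE; last first.
  by apply: integral_ge0 => t _; rewrite lee_fin site_density_ge0.
apply: (@le_lt_trans _ _ (expR `|v| * gauss_mass)%:E); last exact: ltry.
rewrite -integral_gaussianZ ?expR_ge0//; apply: ge0_le_integralT => t.
  by rewrite lee_fin site_density_ge0.
by rewrite lee_fin; case/andP: (site_density_bounds v t).
Qed.

Lemma site_mass_ge v : expR (- `|v|) * gauss_mass <= site_mass v.
Proof.
rewrite -lee_fin -site_massE -integral_gaussianZ ?expR_ge0//.
apply: ge0_le_integralT => t; last first.
  by rewrite lee_fin; case/andP: (site_density_bounds v t).
by rewrite lee_fin mulr_ge0 ?expR_ge0.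
Qed.

Lemma site_mass_gt0 v : 0 < site_mass v.
Proof. exact: lt_le_trans (mulr_gt0 (expR_gt0 _) gauss_mass_gt0) (site_mass_ge v). Qed.

Lemma iterint_weight V (r : seq (site d)) phi : uniq r ->
  (iterint leb r (fun psi => (weight r (fun x => site_density (V x)) psi)%:E) phi =
   (\prod_(x <- r) site_mass (V x))%:E)%E.
Proof.
elim: r phi => [|x r IH] phi /=; first by rewrite /weight !big_nil.
move=> /andP[xr ur].
transitivity (\int[leb]_t ((site_density (V x) t)%:E *
    (\prod_(y <- r) site_mass (V y))%:E))%E.
  apply: eq_integral => t _; rewrite -(IH (update phi x t) ur).
  transitivity (iterint leb r (fun psi : site d -> RR => (site_density (V x) (psi x))%:E *
      (weight r (fun y => site_density (V y)) psi)%:E)%E (update phi x t)).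
    by apply: eq_iterint_off => psi _; rewrite /weight big_cons EFinM.
  rewrite iterint_factor.
  - by rewrite updateE eqxx.
  - by move=> psi; rewrite lee_fin; apply: weight_ge0 => y u; exact: site_density_ge0.
  - by move=> psi; rewrite lee_fin; exact: site_density_ge0.
  - by apply: coord_measurable_weight => y; exact: measurable_site_density.
  - by move=> psi -> //.
under eq_integral do rewrite muleC.
rewrite ge0_integralZl_EFin//.
- by rewrite site_massE big_cons EFinM muleC.
- by move=> t _; rewrite lee_fin site_density_ge0.
- by apply/measurable_EFinP; exact: measurable_site_density.
- by rewrite prodr_ge0// => y _; exact: ltW (site_mass_gt0 _).
Qed.

Local Notation spinV V := (fun x => site_density (V x)).

(** The sites of [L] outside [A] carry no coupling and integrate to their [site_mass]. Partition
    functions of different volumes thereby become integrals over one volume with different sets of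
    edges. *)
Lemma spin_integral_sub V J A L (l : seq (site d * site d)) : (A `<=` L)%fset ->
  (forall e, e \in l -> (e.1 \in A) && (e.2 \in A)) ->
  (spin_integral L (spinV V) J l (fun=> 0%R) =
   spin_integral A (spinV V) J l (fun=> 0%R) *
     (\prod_(x <- (L `\` A)%fset) site_mass (V x))%:E)%E.
Proof.
move=> AL lA.
have LA : perm_eq L (A ++ (L `\` A)%fset).
  apply: uniq_perm; first exact: fset_uniq.
    rewrite cat_uniq !fset_uniq andbT/=; apply/hasPn => x.
    by rewrite inE => /andP[].
  by move=> x; rewrite mem_cat inE; case: (boolP (x \in A)) => //= /(fsubsetP AL).
have m0 (s : seq (site d)) phi : 0 <= weight s (spinV V) phi.
  by apply: weight_ge0 => x t; exact: site_density_ge0.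
have mw (s : seq (site d)) : coord_measurable (fun phi : site d -> RR => (weight s (spinV V) phi)%:E).
  by apply: coord_measurable_weight => x; exact: measurable_site_density.
have ms (s : seq (site d)) : coord_measurable (fun phi : site d -> RR =>
    (weight s (spinV V) phi * expR (J * pair_energy l phi))%:E).
  by apply: coord_measurable_spin => x; exact: measurable_site_density.
rewrite /spin_integral (@perm_iterint _ _ _ _ _ L (A ++ (L `\` A)%fset))//; last first.
  by move=> psi; rewrite lee_fin mulr_ge0 ?expR_ge0.
rewrite iterint_cat muleC -iterintZl//.
- apply: eq_iterint_off => phi _; rewrite muleC -(iterint_weight _ phi (fset_uniq _)).
  rewrite -(@iterint_factor _ _ _ _ _ _ (fun psi => (weight _ _ psi)%:E)
    (fun psi : site d -> RR => (weight A (spinV V) psi * expR (J * pair_energy l psi))%:E))//.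
  + apply: eq_iterint_off => psi _; rewrite -EFinM; congr EFin.
    rewrite [weight L _ _](perm_big _ LA) big_cat/= -!/(weight _ _ _).
    by rewrite mulrAC.
  + by move=> psi; rewrite lee_fin.
  + by move=> psi; rewrite lee_fin mulr_ge0 ?expR_ge0.
  + move=> psi psiE; have psiA x : x \in A -> psi x = phi x.
      by move=> xA; apply: psiE; rewrite inE xA.
    congr (_ * expR (J * _))%:E.
      by rewrite /weight; apply: eq_big_seq => x xA; rewrite psiA.
    by apply: eq_big_seq => e /lA/andP[e1 e2]; rewrite !psiA.
- by rewrite lee_fin prodr_ge0// => y _; exact: ltW (site_mass_gt0 _).
- by move=> psi; rewrite lee_fin mulr_ge0 ?expR_ge0.
Qed.

End partition.

(** Stated for total preorders: one use is the lexicographic order, the other compares a single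
    coordinate and has ties. *)
Lemma fset_max_ind (K : choiceType) (le : rel K) (P : {fset K} -> Prop) :
  total le -> transitive le -> P fset0 ->
  (forall x A, x \notin A -> {in A, forall y, le y x} -> P A -> P (x |` A)%fset) ->
  forall A, P A.
Proof.
move=> le_total le_trans P0 PU A.
have [n] := ubnP #|` A|; elim: n A => // n IH A; rewrite ltnS => An.
have [->//|[x0 x0A]] := fset_0Vmem A.
have [x xA xmax] : exists2 x, x \in A & {in A, forall y, le y x}.
  have : forall s : seq K, s != [::] -> exists2 x, x \in s & {in s, forall y, le y x}.
    elim=> // x [|y s] IHs _.
      by exists x; rewrite ?mem_head// => y; rewrite inE => /eqP ->; case/orP: (le_total x x).
    have [//|z zs zmax] := IHs; have [xz|zx] := orP (le_total x z).
      exists z => [|w]; first by rewrite inE zs orbT.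
      by rewrite inE => /orP[/eqP ->//|/zmax].
    exists x => [|w]; first exact: mem_head.
    rewrite inE => /orP[/eqP ->|/zmax wz]; first by case/orP: (le_total x x).
    exact: le_trans wz zx.
  apply; apply/eqP => A0; move: x0A; rewrite -[x0 \in A]/(x0 \in enum_fset A) A0.
  by rewrite in_nil.
rewrite -(fsetD1K xA); apply: PU.
- by rewrite !inE eqxx.
- by move=> y; rewrite !inE => /andP[_ /xmax].
- by apply: IH; apply: leq_trans An; rewrite [X in (_ < X)%N](cardfsD1 x) xA.
Qed.

(** * Supermodularity and comparison bounds for the partition function *)

Section pinned_bounds.
Context {R : realType} {d : nat}.
Hypothesis d0 : (0 < d)%N.
Variable a : R.
Local Notation RR := (measurableTypeR R).
Local Notation leb := (@lebesgue_measure R).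
Local Notation Z := (pinned_partition a).
Local Notation J := ((2 * d)%:R^-1 : R).
Local Notation spinV V := (fun x => site_density a (V x)).
Implicit Types (L A B : {fset site d}) (V : site d -> R) (x : site d).

Let inside A (e : site d * site d) := (e.1 \in A) && (e.2 \in A).

Lemma pair_energy_inside A L phi : (A `<=` L)%fset ->
  pair_energy [seq e <- inner_edges L | inside A e] phi =
  pair_energy (inner_edges A) phi :> R.
Proof.
move=> AL; rewrite /pair_energy big_filter !sum_inner_edges.
apply: eq_bigr => i _; rewrite -big_filter -[RHS]big_filter.
apply: perm_big; apply: uniq_perm; rewrite ?filter_uniq ?fset_uniq//.
move=> x; rewrite !mem_filter /inside/= andbT.
case xA: (x \in A); last by rewrite !andbF.
case yA: (x + basis_vec i \in A); last by rewrite !andbF.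
by rewrite !(fsubsetP AL).
Qed.

Lemma eq_spin_integral (s : seq (site d)) p K (l1 l2 : seq (site d * site d)) phi :
  (forall psi, pair_energy l1 psi = pair_energy l2 psi :> R) ->
  spin_integral s p (K : R) l1 phi = spin_integral s p K l2 phi.
Proof.
by move=> l12; apply: eq_iterint_off => psi _; rewrite l12.
Qed.

Lemma spin_integral_inside V A L : (A `<=` L)%fset ->
  (spin_integral L (spinV V) J [seq e <- inner_edges L | inside A e] (fun=> 0%R) =
   Z V A * (\prod_(x <- (L `\` A)%fset) site_mass a (V x))%:E)%E.
Proof.
move=> AL; rewrite (spin_integral_sub a V J AL); last first.
  by move=> e; rewrite mem_filter => /andP[].
rewrite (pinned_partition_spin d0); congr (_ * _)%E.
by apply: eq_spin_integral => psi; exact: pair_energy_inside.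
Qed.

Lemma site_mass_prod_gt0 V (s : seq (site d)) : 0 < \prod_(x <- s) site_mass a (V x).
Proof. by rewrite prodr_gt0// => x _; exact: site_mass_gt0. Qed.

Lemma inner_edges_inside L e : e \in inner_edges L -> inside L e.
Proof.
by rewrite mem_filter => /andP[e2 /allpairsP[[i y] [_ yL eE]]]; rewrite /inside e2 eE yL.
Qed.

(** All four partition functions are written over the largest volume [L], up to site masses, and
    compared by [griffiths]. *)
Theorem pinned_partition_supermodular V A B x : (A `<=` B)%fset -> x \notin B ->
  (Z V (x |` A)%fset * Z V B <= Z V (x |` B)%fset * Z V A)%E.
Proof.
move=> AB xB; set L := (x |` B)%fset; set E := inner_edges L.
have xA : x \notin A by apply: contra xB => /(fsubsetP AB).
have BL : (B `<=` L)%fset by exact: fsubsetU1.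
have AL : (A `<=` L)%fset by exact: fsubset_trans AB BL.
have AxL : ((x |` A) `<=` L)%fset by exact: fsetUS.
(* The edges of [L] are split into those inside [A], those joining [x] to [A], the other edges
   inside [B], and those joining [x] to the sites of [B] outside [A]. *)
pose l0 := [seq e <- E | inside A e].
pose k := [seq e <- E | inside (x |` A)%fset e && ~~ inside A e].
pose m := [seq e <- E | inside B e && ~~ inside A e].
pose n := [seq e <- E | ~~ inside (x |` A)%fset e && ~~ inside B e].
have sub1 e : inside A e -> inside (x |` A)%fset e.
  by move=> /andP[e1 e2]; rewrite /inside !in_fset1U e1 e2 !orbT.
have sub2 e : inside A e -> inside B e.
  by move=> /andP[/(fsubsetP AB) e1 /(fsubsetP AB) e2]; rewrite /inside e1 e2.
have sub3 e : inside (x |` A)%fset e -> inside B e -> inside A e.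
  rewrite /inside !in_fset1U => /andP[/orP[/eqP ->|->]]; first by rewrite (negbTE xB).
  by move=> /orP[/eqP ->|->] //; rewrite (negbTE xB) andbF.
have pe (q : pred (site d * site d)) (psi : site d -> R) : pair_energy [seq e <- E | q e] psi =
    \sum_(e <- E) (if q e then psi e.1 * psi e.2 else 0).
  by rewrite /pair_energy big_filter big_mkcond.
have e1 psi : pair_energy (l0 ++ k) psi = pair_energy [seq e <- E | inside (x |` A)%fset e] psi :> R.
  rewrite pair_energy_cat !pe -big_split; apply: eq_bigr => e _ /=.
  have := sub1 e; case: (inside A e); case: (inside (x |` A)%fset e) => //= h;
    rewrite ?addr0 ?add0r//; by have := h isT.
have e2 psi : pair_energy (l0 ++ m) psi = pair_energy [seq e <- E | inside B e] psi :> R.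
  rewrite pair_energy_cat !pe -big_split; apply: eq_bigr => e _ /=.
  have := sub2 e; case: (inside A e); case: (inside B e) => //= h;
    rewrite ?addr0 ?add0r//; by have := h isT.
have e3 psi : pair_energy (l0 ++ k ++ m ++ n) psi = pair_energy E psi :> R.
  rewrite !pair_energy_cat !pe -!big_split; apply: eq_bigr => e _ /=.
  have := sub1 e; have := sub2 e; have := sub3 e.
  case: (inside (x |` A)%fset e); case: (inside A e); case: (inside B e) => //=;
    rewrite ?addr0 ?add0r// => h1 h2 h3; first [by have := h2 isT | by have := h3 isT | by have := h1 isT isT].
have esub e : e \in l0 ++ k ++ m ++ n -> (e.1 \in L) && (e.2 \in L).
  have memE (Q : pred (site d * site d)) : e \in [seq e <- E | Q e] -> inside L e.
    by rewrite mem_filter => /andP[_]; exact: inner_edges_inside.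
  by rewrite !mem_cat => /or4P[] /memE.
have J0 : 0 <= J by rewrite invr_ge0.
have p0 y t : 0 <= site_density a (V y) t by exact: site_density_ge0.
have pev y t : site_density a (V y) (- t) = site_density a (V y) t by exact: site_density_even.
have mp y : measurable_fun [set: R] (site_density a (V y)) by exact: measurable_site_density.
have := griffiths (fset_uniq L) J0 p0 pev mp (fun=> 0) esub.
rewrite (eq_spin_integral _ _ _ _ e1) (eq_spin_integral _ _ _ _ e2).
rewrite (eq_spin_integral _ _ _ _ e3) !spin_integral_inside// -pinned_partition_spin//.
have -> : (L `\` (x |` A))%fset = (B `\` A)%fset.
  by apply/fsetP => y; rewrite !inE; case: eqVneq => // ->; rewrite (negbTE xB) andbF.
have -> : (L `\` B)%fset = [fset x]%fset.
  by apply/fsetP => y; rewrite !inE; case: eqVneq => [->|_]; rewrite ?xB// andNb.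
have -> : (L `\` A)%fset = (x |` (B `\` A))%fset.
  by apply/fsetP => y; rewrite !inE; case: eqVneq => [->|_]; rewrite ?xA.
(* Both sides carry the same positive factor: the mass of [x] and the masses of the sites of [B]
   outside [A]. *)
rewrite big_fsetU1/= ?inE ?xA// big_seq_fset1 muleACA -EFinM [in leRHS]muleA.
rewrite [X in (_ * _ * X%:E <= _)%E]mulrC lee_pmul2r// lte_fin mulr_gt0 ?site_mass_gt0//.
exact: site_mass_prod_gt0.
Qed.

(** [griffiths] with [l0], [k] and [m] empty and [n] all edges: turning on the couplings increases
    the integral, which without couplings is a product. *)
Lemma pinned_partition_ge V L : ((\prod_(x <- L) site_mass a (V x))%:E <= Z V L)%E.
Proof.
have J0 : 0 <= J by rewrite invr_ge0.
have p0 y t : 0 <= site_density a (V y) t by exact: site_density_ge0.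
have pev y t : site_density a (V y) (- t) = site_density a (V y) t by exact: site_density_even.
have mp y : measurable_fun [set: R] (site_density a (V y)) by exact: measurable_site_density.
have esub e : e \in [::] ++ [::] ++ [::] ++ inner_edges L -> (e.1 \in L) && (e.2 \in L).
  exact: inner_edges_inside.
have := griffiths (fset_uniq L) J0 p0 pev mp (fun=> 0) esub.
rewrite /= -pinned_partition_spin//.
have -> : spin_integral L (spinV V) J [::] (fun=> 0) = (\prod_(x <- L) site_mass a (V x))%:E.
  rewrite -(iterint_weight a V (fun=> 0)) ?fset_uniq//; apply: eq_iterint_off => psi _.
  by rewrite /pair_energy big_nil mulr0 expR0 mulr1.
by rewrite lee_pmul2r// lte_fin site_mass_prod_gt0.
Qed.

Lemma pinned_partition_le V V' L :
  (Z V L <= (expR (\sum_(x <- L) `|V x - V' x|))%:E * Z V' L)%E.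
Proof.
have w0 W (phi : site d -> RR) : 0 <= weight L (spinV W) phi.
  by apply: weight_ge0 => x t; exact: site_density_ge0.
have f0 W (phi : site d -> RR) :
    (0 <= (weight L (spinV W) phi * expR (J * pair_energy (inner_edges L) phi))%:E)%E.
  by rewrite lee_fin mulr_ge0 ?expR_ge0.
have mf W : coord_measurable (fun phi : site d -> RR =>
    (weight L (spinV W) phi * expR (J * pair_energy (inner_edges L) phi))%:E).
  by apply: coord_measurable_spin => x; exact: measurable_site_density.
rewrite !pinned_partition_spin// /spin_integral -iterintZl ?lee_fin ?expR_ge0//.
apply: iterint_le_off => psi; first by rewrite lee_fin mulr_ge0 ?expR_ge0.
move=> _; rewrite -EFinM lee_fin mulrA ler_wpM2r ?expR_ge0// /weight.
rewrite expR_sum -big_split/=; apply: ler_prod => x _; rewrite expR_ge0/=.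
rewrite /site_density -expRD ler_expR addrCA lerD2l -lerBlDr -mulrBl.
exact: le_trans (ler_norm _) (indic_norm_le _ _ _).
Qed.

End pinned_bounds.

(** * Finiteness and the corrected logarithm of the partition function *)

Section pinned_functional.
Context {R : realType} {d : nat}.
Hypothesis d0 : (0 < d)%N.
Variable a : R.
Local Notation RR := (measurableTypeR R).
Local Notation leb := (@lebesgue_measure R).
Local Notation Z := (pinned_partition a).
Local Notation J := ((2 * d)%:R^-1 : R).
Local Notation spinV V := (fun x => site_density a (V x)).
Implicit Types (L A B : {fset site d}) (V : site d -> R) (x : site d).

Let i0 : 'I_d := Ordinal d0.
Let e0 : site d := basis_vec i0.
(** Variance [2 * d], so that [step u] is [expR (- u ^+ 2 / (4 * d))], the weight of one edge in the
    Hamiltonian. *)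
Let sigma : R := Num.sqrt (2 * d)%:R.
Let step (u : R) : R := expR (- u ^+ 2 / (sigma ^+ 2 *+ 2)).

Let sigma_neq0 : sigma != 0.
Proof. by rewrite gt_eqF// sqrtr_gt0 ltr0n muln_gt0. Qed.

Let e0i : e0 0 i0 = 1. Proof. by rewrite mxE !eqxx. Qed.

Let mstep : measurable_fun [set: R] step.
Proof.
rewrite /step; apply: measurableT_comp => //=; apply: measurable_funM => //=.
by apply: measurableT_comp => //=; exact: measurable_funX.
Qed.

(* Only the edges parallel to [e0] are kept; integrating the sites by increasing
   coordinate [i0] from the inside, each integral is a Gaussian one. *)
Lemma iterint_chain A (phi : site d -> RR) :
  iterint leb A (fun psi : site d -> RR =>
    (\prod_(y <- A) step (psi y - psi (y - e0)%R))%:E) phi =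
  (((normal_peak sigma)^-1) ^+ #|` A|)%:E.
Proof.
elim/(@fset_max_ind _ (fun x y => x 0 i0 <= y 0 i0)): A phi => [x y|y x z|phi|x A xA xmax IH phi].
- exact: le_total.
- exact: le_trans.
- by rewrite cardfs0 expr0 [LHS]/= big_seq_fset0.
have sub_neq y : y - e0 != y.
  by rewrite -subr_eq0 addrAC subrr add0r oppr_eq0; apply/eqP => /matrixP/(_ 0 i0);
    rewrite e0i mxE.
(* [x] has the largest coordinate [i0], so no factor indexed by [A] involves it. It is integrated
   innermost, against the single factor centred at [psi (x - e0)]. *)
have max_neq y : y \in A -> y - e0 != x.
  move=> /xmax yx; apply: contraTneq yx => <-.
  by rewrite -ltNge !mxE eqxx/= ltrBlDr ltrDl.
have step0 u : 0 <= step u by exact: expR_ge0.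
have mprod (s : seq (site d)) : coord_measurable (fun psi : site d -> RR =>
    (\prod_(y <- s) step (psi y - psi (y - e0)%R))%:E).
  move=> d1 T g mg; apply/measurable_EFinP; apply: measurable_prod => y _.
  have mgB : measurable_fun [set: T] (fun u => (g u y : R) - g u (y - e0)).
    by apply: measurable_funB; exact: mg.
  exact: (measurableT_comp mstep mgB).
have xAE : perm_eq (x |` A)%fset (A ++ [:: x]).
  apply: uniq_perm; first exact: fset_uniq.
    by rewrite cat_uniq fset_uniq/= orbF andbT.
  by move=> y; rewrite mem_cat !inE orbC.
rewrite (@perm_iterint _ _ _ _ _ _ (A ++ [:: x]))//; last first.
  by move=> psi; rewrite lee_fin prodr_ge0.
rewrite iterint_cat cardfsU1 xA add1n exprS EFinM -(IH phi) -iterintZl//; last 2 first.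
- by rewrite lee_fin invr_ge0 normal_peak_ge0.
- by move=> psi; rewrite lee_fin prodr_ge0.
apply: eq_iterint_off => psi _ /=.
transitivity (\int[leb]_t ((\prod_(y <- A) step (psi y - psi (y - e0)%R))%:E *
    (step (t - psi (x - e0)%R))%:E))%E.
  apply: eq_integral => t _; rewrite big_fsetU1//= mulrC EFinM; congr (_%:E * _%:E)%E.
    apply: eq_big_seq => y yA; rewrite !updateE (negbTE (max_neq _ yA)).
    by case: eqVneq => // yx; move: xA; rewrite -yx yA.
  by rewrite !updateE eqxx (negbTE (sub_neq x)).
have ms : measurable_fun [set: R] (fun t : R => (step (t - psi (x - e0)))%:E).
  have mB : measurable_fun [set: R] (fun t : R => t - psi (x - e0)) by exact: measurable_funB.
  by apply/measurable_EFinP; exact: (measurableT_comp mstep mB).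
rewrite ge0_integralZl_EFin//.
- by rewrite /step integral_gaussian// muleC.
- by move=> t _; rewrite lee_fin.
- exact: prodr_ge0.
Qed.

Lemma hamiltonian_ge L (phi : site d -> R) :
  (4 * d)%:R^-1 * \sum_(x <- L) (phi x - phi (x - e0)) ^+ 2 <= hamiltonian L phi.
Proof.
rewrite /hamiltonian ler_wpM2l ?invr_ge0 ?ler0n// (bigD1 i0)//=.
rewrite -[leLHS]addr0 lerD//; last by do 2!apply: sumr_ge0 => ? _; exact: sqr_ge0.
pose T := [fset (y - e0)%R | y in L]%fset.
have TE : (T `<=` edges_touching L i0)%fset by exact: fsubsetUr.
apply: (@le_trans _ _ (\sum_(x <- edges_touching L i0)
    (if x \in T then (phi (x + e0) - phi x) ^+ 2 else 0))); last first.
  by apply: ler_sum => x _; case: ifP => // _; exact: sqr_ge0.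
rewrite -(big_fset_incl _ TE)/=; last by move=> x _ /negbTE ->.
rewrite big_imfset/=; last by move=> x y _ _ /addIr.
rewrite le_eqVlt; apply/orP; left; apply/eqP; apply: eq_big_seq => x xL.
have -> : x - e0 \in T by apply/imfsetP; exists x.
by rewrite subrK.
Qed.

(** This bound yields the finiteness of every partition function and the linear growth of its
    logarithm. *)
Lemma free_partition_le L :
  (Z (fun=> 0%R) L <= (((normal_peak sigma)^-1) ^+ #|` L|)%:E)%E.
Proof.
rewrite /pinned_partition /partition_function field_integralE -(iterint_chain L (fun=> 0)).
apply: iterint_le_off => [psi|psi _]; first by rewrite lee_fin expR_ge0.
rewrite lee_fin -expR_sum ler_expR big1 ?addr0; last by move=> x _; rewrite mul0r.
rewrite -mulr_suml sumrN mulNr lerN2; apply: le_trans (hamiltonian_ge L psi).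
rewrite /sigma sqr_sqrtr ?ler0n// mulrC le_eqVlt; apply/orP; left; apply/eqP.
by congr (_^-1 * _); rewrite -mulr_natl -natrM; congr _%:R; lia.
Qed.

Lemma pinned_partition_lty V L : (Z V L < +oo)%E.
Proof.
apply: le_lt_trans (pinned_partition_le d0 a V (fun=> 0) L) _.
apply: le_lt_trans (lee_wpmul2l _ (free_partition_le L)) _; last by rewrite -EFinM ltry.
by rewrite lee_fin expR_ge0.
Qed.

Lemma pinned_partition_gt0 V L : (0 < Z V L)%E.
Proof.
apply: lt_le_trans (pinned_partition_ge d0 a V L).
by rewrite lte_fin site_mass_prod_gt0.
Qed.

Definition realZ V L : R := fine (Z V L).

Lemma realZE V L : (realZ V L)%:E = Z V L.
Proof.
rewrite /realZ fineK// ge0_fin_numE; first exact: pinned_partition_lty.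
exact: ltW (pinned_partition_gt0 _ _).
Qed.

Lemma realZ_gt0 V L : 0 < realZ V L.
Proof. by rewrite -lte_fin realZE pinned_partition_gt0. Qed.

Lemma pinned_partition_shift V L z :
  Z V [fset (x + z)%R | x in L]%fset = Z (fun x => V (x + z)) L.
Proof.
set Lz := [fset _ | _ in _]%fset.
have LzE : perm_eq Lz [seq x + z | x <- L].
  apply: uniq_perm; first exact: fset_uniq.
    by rewrite map_inj_uniq ?fset_uniq//; exact: addIr.
  move=> y; apply/imfsetP/mapP => -[x xL ->]; by exists x.
have sum_shift (f : site d -> R) : \sum_(x <- Lz) f x = \sum_(x <- L) f (x + z).
  by rewrite (perm_big _ LzE) big_map.
pose Phi (psi : site d -> RR) : site d -> RR := fun x => psi (x - z).
have PhiE psi x t : x \in enum_fset L -> Phi (update psi x t) = update (Phi psi) (x + z) t.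
  by move=> _; apply/funext => y; rewrite /Phi !updateE subr_eq.
rewrite !pinned_partition_spin// /spin_integral.
rewrite (@perm_iterint _ _ _ _ _ _ [seq x + z | x <- L])//.
- have -> : (fun=> 0) = Phi (fun=> 0) by [].
  rewrite (iterint_map leb _ PhiE); apply: eq_iterint_off => psi _ /=.
  congr (_ * expR (J * _))%:E.
    rewrite /weight (perm_big _ LzE) big_map; apply: eq_bigr => x _.
    by rewrite /Phi addrK.
  rewrite /pair_energy !sum_inner_edges; apply: eq_bigr => i _.
  rewrite big_mkcond [RHS]big_mkcond sum_shift; apply: eq_bigr => x _ /=.
  rewrite /Phi addrK addrAC addrK.
  have -> // : (x + basis_vec i + z \in Lz) = (x + basis_vec i \in L).
  by rewrite (perm_mem LzE) (mem_map (f := fun y => y + z)) //; exact: addIr.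
- exact: fset_uniq.
- by move=> psi; rewrite lee_fin mulr_ge0 ?expR_ge0//; apply: weight_ge0 => y t; exact: site_density_ge0.
- by apply: coord_measurable_spin => y; exact: measurable_site_density.
Qed.

(** Here the potential depends on the parameter while the field is integrated, which calls for the
    parametrized form of measurability. *)
Lemma coord_measurable_pinned L : coord_measurable (fun V : site d -> R => Z V L).
Proof.
move=> d1 T g mg.
have E : (fun u => Z (g u) L) = (fun u => iterint leb L (fun phi : site d -> RR =>
    (weight L (spinV (g u)) phi * expR (J * pair_energy (inner_edges L) phi))%:E) (fun=> 0)).
  by apply/funext => u; rewrite pinned_partition_spin.
rewrite E; apply: (@param_measurable_iterint _ _ _ _ leb _ T L
  (fun u (phi : site d -> RR) =>
    (weight L (spinV (g u)) phi * expR (J * pair_energy (inner_edges L) phi))%:E)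
  _ _ _ T id (fun _ _ => 0)) => //.
- move=> u phi; rewrite lee_fin mulr_ge0 ?expR_ge0//.
  by apply: weight_ge0 => y t; exact: site_density_ge0.
- move=> d2 S p h mp mh; apply/measurable_EFinP; apply: measurable_funM.
    apply: measurable_prod => x _; apply: measurableT_comp => //.
    apply: measurable_funD.
      apply: measurableT_comp => //; apply: measurable_funM => //.
      by apply: measurable_funX; exact: mh.
    apply: measurable_funM; first exact: (measurableT_comp (mg x) mp).
    have mind : measurable_fun [set: R] (\1_`[- a, a] : R -> R) by exact: measurable_indic.
    exact: (measurableT_comp mind (mh x)).
  apply/measurable_EFinP.
  exact: (@coord_measurable_expR_energy _ _ J (inner_edges L)).
Qed.

(* The correction makes the logarithm nonnegative and increasing in the volume. *)
Definition log_partition V L : R :=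
  ln (realZ V L) + \sum_(x <- L) (`|V x| - ln gauss_mass).

Lemma log_partition0 V : log_partition V fset0 = 0.
Proof.
rewrite /log_partition big_seq_fset0 addr0 /realZ pinned_partition_spin//.
rewrite /spin_integral [iterint _ _ _ _]/= /weight big_nil /pair_energy sum_inner_edges.
by rewrite big1 ?mulr0 ?expR0 ?mulr1 ?ln1// => i _; rewrite big_nil.
Qed.

Lemma log_partition_supermodular V A B x : (A `<=` B)%fset -> x \notin B ->
  log_partition V (x |` A)%fset - log_partition V A <=
  log_partition V (x |` B)%fset - log_partition V B.
Proof.
move=> AB xB; have xA : x \notin A by apply: contra xB => /(fsubsetP AB).
rewrite /log_partition !big_fsetU1//=.
have := pinned_partition_supermodular d0 a V AB xB.
rewrite -!realZE -!EFinM lee_fin -ler_ln ?posrE ?mulr_gt0 ?realZ_gt0//.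
by rewrite !lnM ?posrE ?realZ_gt0//; lra.
Qed.

(** By supermodularity the increment at [x] is smallest when [A] is empty. There it is at least [ln
    (site_mass a (V x)) + |V x| - ln gauss_mass], which [site_mass_ge] makes nonnegative; the
    correction is chosen for this. *)
Lemma log_partition_incr V A x : x \notin A ->
  log_partition V A <= log_partition V (x |` A)%fset.
Proof.
move=> xA; rewrite -subr_ge0.
apply: le_trans (log_partition_supermodular V (fsub0set A) xA).
rewrite log_partition0 subr0 /log_partition big_fsetU1//= big_seq_fset0 addr0.
have := pinned_partition_ge d0 a V (x |` fset0)%fset.
rewrite -realZE lee_fin big_fsetU1//= big_seq_fset0 mulr1.
have := site_mass_ge a (V x); have gm := @gauss_mass_gt0 R.
move=> h1 /(le_trans h1); rewrite -ler_ln ?posrE ?mulr_gt0 ?expR_gt0 ?realZ_gt0//.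
by rewrite lnM ?posrE ?expR_gt0// expRK; lra.
Qed.

(** The constant 2 counts the logarithm once and the correction [|V x|] once. *)
Lemma log_partition_lipschitz V V' L :
  `|log_partition V L - log_partition V' L| <= 2 * \sum_(x <- L) `|V x - V' x|.
Proof.
have key W W' : ln (realZ W L) - ln (realZ W' L) <= \sum_(x <- L) `|W x - W' x|.
  have := pinned_partition_le d0 a W W' L.
  rewrite -!realZE -EFinM lee_fin -ler_ln ?posrE ?mulr_gt0 ?expR_gt0 ?realZ_gt0//.
  by rewrite lnM ?posrE ?expR_gt0 ?realZ_gt0// expRK; lra.
have sum_le : `|\sum_(x <- L) (`|V x| - ln gauss_mass) -
    \sum_(x <- L) (`|V' x| - ln gauss_mass)| <= \sum_(x <- L) `|V x - V' x|.
  rewrite -sumrB; apply: le_trans (ler_norm_sum _ _ _) _; apply: ler_sum => x _.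
  by rewrite opprB addrA subrK; exact: ler_dist_dist.
have k1 := key V V'; have k2 := key V' V.
have E : \sum_(x <- L) `|V' x - V x| = \sum_(x <- L) `|V x - V' x|.
  by apply: eq_bigr => x _; rewrite distrC.
move: sum_le; rewrite E in k2; rewrite !ler_norml /log_partition => /andP[h1 h2].
by apply/andP; split; lra.
Qed.

Lemma log_partition_free_le : exists2 C : R, 0 <= C & forall L,
  log_partition (fun=> 0) L <= C * #|` L|%:R.
Proof.
pose c := ln ((normal_peak sigma)^-1) - ln gauss_mass.
exists (Num.max 0 c) => [|L]; first by rewrite le_max lexx.
apply: (@le_trans _ _ (c * #|` L|%:R)); last first.
  by rewrite ler_wpM2r ?ler0n// le_max lexx orbT.
have pk : 0 < (normal_peak sigma)^-1 by rewrite invr_gt0 normal_peak_gt0.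
have h : ln (realZ (fun=> 0) L) <= ln ((normal_peak sigma)^-1) * #|` L|%:R.
  rewrite mulr_natr -lnXn// ler_ln ?posrE ?exprn_gt0 ?realZ_gt0//.
  by rewrite -lee_fin realZE free_partition_le.
rewrite /log_partition normr0 sub0r big_const_seq count_predT iter_addr_0 mulrBl.
by rewrite mulNrn [X in _ <= _ - X]mulr_natr lerD2r.
Qed.

Lemma log_partition_shift V L z :
  log_partition V [fset (x + z)%R | x in L]%fset = log_partition (fun x => V (x + z)) L.
Proof.
rewrite /log_partition /realZ pinned_partition_shift big_imfset//=.
by move=> x y _ _ /addIr.
Qed.

Lemma coord_measurable_log_partition L :
  coord_measurable (fun V : site d -> R => (log_partition V L)%:E).
Proof.
move=> d1 T g mg; apply/measurable_EFinP; apply: measurable_funD.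
  apply: (measurableT_comp (@measurable_ln R)).
  apply: (measurableT_comp (@fine_measurable R setT measurableT)).
  exact: coord_measurable_pinned.
apply: measurable_sum => x; apply: measurable_funD => //.
exact: (measurableT_comp (@normr_measurable R setT) (mg x)).
Qed.

End pinned_functional.

(** * Limits of supermodular set functions *)

Lemma leq_cardfsU (K : choiceType) (A B : {fset K}) :
  (#|` (A `|` B)%fset| <= #|` A| + #|` B|)%N.
Proof. by rewrite cardfsU leq_subr. Qed.

(** * Lexicographic order and counting near the boundary *)

Section lattice_order.
Context {d : nat}.
Implicit Types (x y z w : site d) (A L W : {fset site d}).

(** Positive cone of the lexicographic order: the first nonzero coordinate is positive.
    Compatibility with translations makes the past of any site a translate of the past of 0. *)
Definition lex_pos w : bool :=
  [exists i, (0 < w 0 i) && [forall j : 'I_d, (j < i)%N ==> (w 0 j == 0)]].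

Definition lex_le x y : bool := (x == y) || lex_pos (y - x).

Lemma lex_posP w : reflect (exists2 i, 0 < w 0 i & forall j : 'I_d, (j < i)%N -> w 0 j = 0)
  (lex_pos w).
Proof.
apply: (iffP existsP) => [[i /andP[wi /forallP wj]]|[i wi wj]]; exists i.
  - by [].
  - by move=> j ji; apply/eqP; exact: (implyP (wj j)).
by rewrite wi/=; apply/forallP => j; apply/implyP => ji; rewrite wj.
Qed.

Lemma lex_posD w z : lex_pos w -> lex_pos z -> lex_pos (w + z).
Proof.
move=> /lex_posP[i wi wj] /lex_posP[k zk zj]; apply/lex_posP.
have [ik|ki|ik] := ltngtP i k.
- exists i => [|j ji]; first by rewrite mxE zj// addr0.
  by rewrite mxE wj// zj ?addr0// (ltn_trans ji).
- exists k => [|j jk]; first by rewrite mxE wj// add0r.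
  by rewrite mxE zj// wj ?addr0// (ltn_trans jk).
- have {}ik : i = k by exact: val_inj.
  rewrite -{k}ik in zk zj *; exists i => [|j ji]; first by rewrite mxE addr_gt0.
  by rewrite mxE wj// zj// addr0.
Qed.

Lemma lex_pos0 : lex_pos (0 : site d) = false.
Proof. by apply/lex_posP => -[i]; rewrite mxE ltxx. Qed.

Lemma lex_pos_total w : w != 0 -> lex_pos w || lex_pos (- w).
Proof.
move=> w0; have [k wk] : exists k, w 0 k != 0.
  apply/existsP; apply: contra_neqT w0; rewrite negb_exists => /forallP w0.
  by apply/rowP => j; rewrite mxE; apply/eqP; rewrite -[_ == _]negbK; exact: w0.
pose i := [arg min_(i < k | w 0 i != 0) (i : nat)].
have [wi imin] : w 0 i != 0 /\ forall j : 'I_d, (j < i)%N -> w 0 j = 0.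
  rewrite /i; case: arg_minnP => //= {}i wi imin; split=> // j ji.
  by apply/eqP; apply: contraTT ji => /imin; rewrite leqNgt.
have [wi0|wi0|/esym/eqP] := ltrgtP 0 (w 0 i); last by rewrite (negbTE wi).
  by apply/orP; left; apply/lex_posP; exists i.
apply/orP; right; apply/lex_posP; exists i; first by rewrite mxE oppr_gt0.
by move=> j /imin wj; rewrite mxE wj oppr0.
Qed.

Lemma lex_le_total : total lex_le.
Proof.
move=> x y; rewrite /lex_le eq_sym; have [//|yx] := eqVneq y x.
by rewrite -(opprB y x) lex_pos_total// subr_eq0.
Qed.

Lemma lex_le_trans : transitive lex_le.
Proof.
move=> y x z; rewrite /lex_le => /predU1P[->//|xy] /predU1P[<-|yz]; first by rewrite xy orbT.
by rewrite -(subrKA y) addrC [X in _ || lex_pos X]addrC lex_posD ?orbT.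
Qed.

Lemma lex_max_ind (P : {fset site d} -> Prop) : P fset0 ->
  (forall x A, x \notin A -> {in A, forall y, lex_pos (x - y)} -> P A -> P (x |` A)%fset) ->
  forall A, P A.
Proof.
move=> P0 PU; apply: (fset_max_ind lex_le_total lex_le_trans P0) => x A xA xmax.
apply: PU => // y yA; have /predU1P[yx|//] := xmax _ yA.
by rewrite -yx yA in xA.
Qed.

Definition exits w L : {fset site d} := [fset x in L | (x + w)%R \notin L]%fset.

Lemma exits_neighbour w L : (forall x, (x + w)%R \in neighbours x) ->
  (#|` exits w L| <= #|` boundary L|)%N.
Proof.
move=> wn; apply: (@leq_trans #|` [fset (x + w)%R | x in exits w L]%fset|).
  by rewrite [leqRHS]card_imfset//; exact: addIr.
apply: fsubset_leq_card; apply/fsubsetP => _ /imfsetP[x /= + ->].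
rewrite !inE/= => /andP[xL xwL]; rewrite xwL/=.
by apply/bigfcupP; exists x; rewrite ?xL.
Qed.

Definition exits_controlled w := exists k, forall L,
  (#|` exits w L| <= k * #|` boundary L|)%N.

(** If [x + w + z] has left [L], then either [x + w] already has, or [x + w] is an exit point for
    [z]. With unit steps, which end in the boundary, this covers every vector. *)
Lemma exits_controlledD w z : exits_controlled w -> exits_controlled z ->
  exits_controlled (w + z).
Proof.
move=> [k kw] [l lz]; exists (k + l)%N => L.
have sub : (exits (w + z) L `<=` exits w L `|` [fset (x - w)%R | x in exits z L])%fset.
  apply/fsubsetP => x; rewrite !inE/= => /andP[xL]; rewrite addrA => xwz.
  rewrite xL/=; case xwL: (x + w \in L) => //=.
  by apply/imfsetP; exists (x + w); rewrite ?addrK//= !inE/= xwL.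
rewrite mulnDl; apply: leq_trans (fsubset_leq_card sub) _.
apply: leq_trans (leq_cardfsU _ _) _; apply: leq_add => //.
by rewrite card_imfset; [exact: lz|exact: addIr].
Qed.

Lemma exits_controlled_all w : exits_controlled w.
Proof.
have c0 : exits_controlled 0.
  exists 0%N => L; rewrite mul0n leqn0 cardfs_eq0; apply/eqP/fsetP => x.
  by rewrite !inE/= addr0 andbN.
have cn z n : exits_controlled z -> exits_controlled (z *+ n).
  by move=> cz; elim: n => [|n IH]; rewrite ?mulr0n// mulrS; exact: exits_controlledD.
have cp i : exits_controlled (basis_vec i).
  exists 1%N => L; rewrite mul1n; apply: exits_neighbour => x.
  by rewrite inE; apply/orP; left; apply/imfsetP; exists i.
have cm i : exits_controlled (- basis_vec i).
  exists 1%N => L; rewrite mul1n; apply: exits_neighbour => x.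
  by rewrite inE; apply/orP; right; apply/imfsetP; exists i.
rewrite (row_sum_delta w); elim/big_ind: _ => //; first exact: exits_controlledD.
move=> i _; rewrite -/(basis_vec i); case: (w 0 i) => n.
  by rewrite -[Posz n]natz scaler_nat; exact: cn.
by rewrite NegzE -[Posz n.+1]natz scaleNr scaler_nat -mulNrn; exact: cn.
Qed.

(** The sites around which the whole pattern [W] fits into [L]; all but a multiple of the boundary
    qualify. *)
Definition translates_inside W L : {fset site d} :=
  [fset x in L | all (fun w => (x + w)%R \in L) W]%fset.

Lemma in_translates_inside W L x :
  (x \in translates_inside W L) = (x \in L) && all (fun w => (x + w)%R \in L) W.
Proof. by rewrite !inE. Qed.

Lemma card_translates_inside W : exists k, forall L,
  (#|` L| <= #|` translates_inside W L| + k * #|` boundary L|)%N.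
Proof.
have [k kW] : exists k, forall L, (\sum_(w <- W) #|` exits w L| <= k * #|` boundary L|)%N.
  elim: (enum_fset W) => [|w s [k IH]]; first by exists 0%N => L; rewrite big_nil.
  have [l lw] := exits_controlled_all w; exists (l + k)%N => L.
  by rewrite big_cons mulnDl leq_add.
exists k => L; apply: leq_trans (leq_add (leqnn _) (kW L)).
have : forall s : seq (site d), (#|` L| <= #|` [fset x in L | all (fun w => (x + w)%R \in L) s]%fset|
    + \sum_(w <- s) #|` exits w L|)%N.
  elim => [|w s IH].
    rewrite big_nil addn0; apply: fsubset_leq_card; apply/fsubsetP => x xL.
    by rewrite !inE/= xL.
  rewrite big_cons addnA; apply: leq_trans IH _; rewrite leq_add2r.
  set X := [fset _ | _ in _]%fset; set Y := [fset _ | _ in _]%fset.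
  have sub : (X `<=` Y `|` exits w L)%fset.
    apply/fsubsetP => x; rewrite /X /Y !inE/= => /andP[-> ->]; rewrite andbT/=.
    by case: (x + w \in L).
  exact: leq_trans (fsubset_leq_card sub) (leq_cardfsU _ _).
by apply.
Qed.

End lattice_order.

Section supermodular_limit.
Context {R : realType} {d : nat}.
Variables (m : {fset site d} -> R) (C : R).
Hypothesis m0 : m fset0 = 0.
Hypothesis m_incr : forall (A : {fset site d}) x, x \notin A -> m A <= m (x |` A)%fset.
Hypothesis m_super : forall (A B : {fset site d}) x, (A `<=` B)%fset -> x \notin B ->
  m (x |` A)%fset - m A <= m (x |` B)%fset - m B.
Hypothesis m_shift : forall (A : {fset site d}) (z : site d),
  m [fset (x + z)%R | x in A]%fset = m A.
Hypothesis m_le : forall A : {fset site d}, m A <= C * #|` A|%:R.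
Implicit Types (A L W : {fset site d}) (x y z w : site d).

Let past W := forall w, w \in W -> lex_pos (- w).
Let gain W : R := m (0 |` W)%fset - m W.

Let past0 W : past W -> 0 \notin W.
Proof. by move=> pW; apply/negP => /pW; rewrite oppr0 lex_pos0. Qed.

Let gain_ge0 W : past W -> 0 <= gain W.
Proof. by move=> /past0 W0; rewrite subr_ge0 m_incr. Qed.

Let shiftU1 x W : [fset (y + x)%R | y in (0 |` W)]%fset = (x |` [fset (y + x)%R | y in W])%fset.
Proof.
apply/fsetP => y; apply/imfsetP/fset1UP.
  move=> [z /=]; rewrite in_fset1U => /orP[/eqP -> ->|zW ->]; first by left; rewrite add0r.
  by right; apply/imfsetP; exists z.
move=> [->|/imfsetP[z /= zW ->]].
  by exists 0; rewrite ?add0r//= fset1U1.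
by exists z => //=; rewrite fset1Ur.
Qed.

Let gain_shift x W : m (x |` [fset (y + x)%R | y in W])%fset - m [fset (y + x)%R | y in W]%fset = gain W.
Proof. by rewrite -shiftU1 !m_shift. Qed.

(** Seen from its largest site, the rest of [L] is a finite part of the past, so each added site
    gains at most [c]. *)
Let m_le_gain c L : (forall W, past W -> gain W <= c) -> m L <= c * #|` L|%:R.
Proof.
move=> gc; elim/(@lex_max_ind d): L => [|x A xA xmax IH]; first by rewrite m0 cardfs0 mulr0.
pose W := [fset (y - x)%R | y in A]%fset.
have AE : A = [fset (y + x)%R | y in W]%fset.
  apply/fsetP => y; apply/idP/imfsetP => [yA|[z /imfsetP[u /= uA ->] ->]].
    by exists (y - x); rewrite ?subrK//; apply/imfsetP; exists y.
  by rewrite subrK.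
have pW : past W by move=> _ /imfsetP[y /= yA ->]; rewrite opprB xmax.
have := gc W pW; rewrite -(gain_shift x) -AE cardfsU1 xA add1n -natr1 mulrDr mulr1.
by move: IH; lra.
Qed.

(** If the translate of [W] by [x] lies in the earlier sites [A], supermodularity bounds the
    increment at [x] below by [gain W]; at the other sites monotonicity suffices. *)
Let m_ge_gain W L : past W -> gain W * #|` translates_inside W L|%:R <= m L.
Proof.
move=> pW; elim/(@lex_max_ind d): L => [|x A xA xmax IH].
  rewrite m0 (_ : translates_inside W fset0 = fset0) ?cardfs0 ?mulr0//.
  by apply/fsetP => y; rewrite !inE.
(* For [y] in [A] the site [y + w] precedes [y], hence is not the new site [x]: adding [x] does not
   change which earlier sites qualify. *)
have sub y : y \in A -> all (fun w => y + w \in (x |` A)%fset) W = all (fun w => y + w \in A) W.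
  move=> yA; apply: eq_in_all => w wW; rewrite in_fset1U.
  case: eqP => //= ywx; exfalso.
  have wpos := lex_posD (pW _ wW) (xmax _ yA).
  by move: wpos; rewrite -ywx addrAC subrr add0r addNr lex_pos0.
have subx : all (fun w => x + w \in (x |` A)%fset) W = all (fun w => x + w \in A) W.
  apply: eq_in_all => w wW; rewrite in_fset1U; case: eqP => //= xwx; exfalso.
  have /eqP := xwx; rewrite -subr_eq0 addrAC subrr add0r => /eqP w0.
  by have := past0 pW; rewrite -w0 wW.
have xt : x \in translates_inside W A = false by rewrite in_translates_inside (negbTE xA).
have tE : translates_inside W (x |` A)%fset =
    if all (fun w => x + w \in A) W then (x |` translates_inside W A)%fset
    else translates_inside W A.
  apply/fsetP => y; have [->|yx] := eqVneq y x.
    rewrite in_translates_inside fset1U1 /= subx.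
    by case: ifP => _; rewrite ?xt// fset1U1.
  transitivity (y \in translates_inside W A).
    rewrite !in_translates_inside in_fset1U (negbTE yx) /=.
    by case yA: (y \in A) => //=; rewrite sub.
  by case: ifP => // _; rewrite in_fset1U (negbTE yx).
rewrite tE; case: ifP => xW; last by apply: le_trans IH _; exact: m_incr.
rewrite cardfsU1 xt add1n -natr1 mulrDr mulr1.
have sA : ([fset (y + x)%R | y in W] `<=` A)%fset.
  by apply/fsubsetP => _ /imfsetP[w /= wW ->]; rewrite addrC (allP xW).
by have := m_super sA xA; rewrite gain_shift; move: IH; lra.
Qed.

Let gain_ratio W : past W -> exists k : R, forall L, (0 < #|` L|)%N ->
  gain W * (1 - k * (#|` boundary L|%:R / #|` L|%:R)) <= m L / #|` L|%:R.
Proof.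
move=> pW; have [k kW] := card_translates_inside W; exists k%:R => L L0.
have L0R : 0 < #|` L|%:R :> R by rewrite ltr0n.
rewrite ler_pdivlMr//; apply: le_trans (m_ge_gain L pW).
rewrite -mulrA ler_wpM2l ?gain_ge0// mulrBl mul1r mulrA divfK ?gt_eqF//.
by rewrite lerBlDr -natrM -natrD ler_nat.
Qed.

Theorem supermodular_limit : exists c : R, forall L : nat -> {fset site d},
  vanishing_boundary R L -> (\forall n \near \oo, (0 < #|` L n|)%N) ->
  m (L n) / #|` L n|%:R @[n --> \oo] --> c.
Proof.
(* The limit is the supremum of the gains over finite pasts, fixed before the sequence [L]. *)
pose E : set R := [set r | exists2 W, past W & r = gain W].
exists (sup E) => L Lvan Lpos.
have ratio W k : (gain W * (1 - k * (#|` boundary (L n)|%:R / #|` L n|%:R)))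
    @[n --> \oo] --> gain W.
  have : (gain W * (1 - k * (#|` boundary (L n)|%:R / #|` L n|%:R)))
      @[n --> \oo] --> gain W * (1 - k * 0).
    apply: cvgM; first exact: cvg_cst.
    by apply: cvgB; [exact: cvg_cst|apply: cvgM; [exact: cvg_cst|exact: Lvan]].
  by rewrite mulr0 subr0 mulr1.
(* The gains are bounded: along [L] the lower bound of [gain_ratio] tends to [gain W], while [m_le]
   keeps the ratio below [C]. *)
have gC W : past W -> gain W <= C.
  move=> pW; have [k kW] := gain_ratio pW.
  apply: (@cvgr_to_le _ _ _ _ _ _ _ (ratio W k)).
  near=> n; apply: le_trans (kW _ _) _; first by near: n.
  by rewrite ler_pdivrMr ?m_le// ltr0n; near: n.
have E0 : E !=set0 by exists (gain fset0); exists fset0 => // w; rewrite inE.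
have Esup : has_sup E by split=> //; exists C => _ [W pW ->]; exact: gC.
have Eub W : past W -> gain W <= sup E by move=> pW; apply: sup_upper_bound => //; exists W.
apply/cvgrPdist_le => eps eps0.
have [_ [W pW ->] Wc] := sup_adherent (divr_gt0 eps0 (ltr0n R 2)) Esup.
have [k kW] := gain_ratio pW.
have /cvgrPdist_le/(_ _ (divr_gt0 eps0 (ltr0n R 2))) := ratio W k.
move=> near_ratio; near=> n.
have n0 : (0 < #|` L n|)%N by near: n.
have h1 := kW _ n0.
have h2 : m (L n) / #|` L n|%:R <= sup E by rewrite ler_pdivrMr ?ltr0n// m_le_gain.
have : `|gain W - gain W * (1 - k * (#|` boundary (L n)|%:R / #|` L n|%:R))| <= eps / 2.
  by near: n.
rewrite ler_distlC => /andP[h3 _]; rewrite ger0_norm ?subr_ge0//.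
by move: h1 h2 h3 Wc; lra.
Unshelve. all: by end_near. Qed.

End supermodular_limit.

(** * Independence and variance *)

Section independent_expectation.
Context {dO} {Omega : measurableType dO} {R : realType} (P : probability Omega R).
Context {I : choiceType} (X : I -> {RV P >-> R}) (X_iid : iid X) (i0 : I).
Local Notation mu := (distribution P (X i0)).
Implicit Types (s : seq I) (env : I -> R).

Definition cylinders : set (set (I -> R)) :=
  [set A | exists (J : {fset I}) (B : I -> set R), (forall i, measurable (B i)) /\
    A = \bigcap_(i in [set` J]) [set phi | B i (phi i)]].

Definition config_space : pointedType := I -> R.

Local Notation CT := (g_sigma_algebraType (T := config_space) cylinders).

Lemma cylinders_setI : setI_closed cylinders.
Proof.
move=> A1 A2 [J1 [B1 [mB1 ->]]] [J2 [B2 [mB2 ->]]].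
pose C (J : {fset I}) (B : I -> set R) i := if i \in J then B i else setT.
exists (J1 `|` J2)%fset, (fun i => C J1 B1 i `&` C J2 B2 i); split.
  by move=> i; apply: measurableI; rewrite /C; case: ifP.
apply/seteqP; split=> phi /=.
  move=> [h1 h2] i /=; rewrite inE => iJ; rewrite /C; split; case: ifP => //.
    by move=> iJ1; exact: h1.
  by move=> iJ2; exact: h2.
move=> h; split=> i /= iJ.
  by have [|+ _] := h i; rewrite /= ?inE ?iJ// /C iJ.
by have [|_] := h i; rewrite /= ?inE ?iJ ?orbT// /C iJ.
Qed.

Lemma measurable_coordinate (i : I) : measurable_fun [set: CT] (fun phi : CT => phi i).
Proof.
move=> _ B mB; rewrite setTI; apply: sub_sigma_algebra.
exists [fset i]%fset, (fun=> B); split=> //; apply/seteqP; split=> phi /=.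
  by move=> h j /=; rewrite inE => /eqP ->.
by move=> /(_ i) /=; apply; rewrite inE.
Qed.

Lemma measurable_config d (S : measurableType d) (g : S -> CT) :
  (forall i, measurable_fun [set: S] (fun u => g u i)) -> measurable_fun [set: S] g.
Proof.
move=> mg; apply: (@measurability _ _ S CT setT g cylinders) => // _ [_ [J [B [mB ->]]] <-].
rewrite setTI preimage_bigcap; apply: fin_bigcap_measurable => [|i _].
  exact: finite_fset.
by rewrite -[X in measurable X]setTI; exact: mg.
Qed.

Definition sample s (w : Omega) env : I -> R := fun i => if i \in s then X i w else env i.

Let measurable_sample s env : measurable_fun [set: Omega] (fun w => sample s w env : CT).
Proof.
apply: measurable_config => i; rewrite /sample.
by case: (i \in s) => //; exact: measurable_cst.
Qed.

Let mass_eq i A : measurable A -> P (X i @^-1` A) = mu A.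
Proof. by move=> mA; rewrite (X_iid.1 i i0). Qed.

(** As functions of [B] both sides are finite measures; independence makes them agree on cylinders,
    which are stable under intersection and generate the sigma-algebra. *)
Lemma sample_independent x s env (A : set R) (B : set CT) : x \notin s ->
  measurable A -> measurable B ->
  (P (X x @^-1` A `&` [set w | B (sample s w env)]) =
   mu A * P [set w | B (sample s w env)])%E.
Proof.
move=> xs mA mB.
have mXA : measurable (X x @^-1` A) by rewrite -[_ @^-1` _]setTI; exact: measurable_funP.
have muA0 : 0 <= fine (mu A) by rewrite fine_ge0.
have muAE : (fine (mu A))%:E = mu A by rewrite fineK// fin_num_measure.
pose Y (w : Omega) : CT := sample s w env.
have mY : measurable_fun [set: Omega] Y by exact: measurable_sample.
have -> : P (X x @^-1` A `&` [set w | B (sample s w env)]) = pushforward (mrestr P mXA) Y B.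
  by rewrite setIC.
pose Ym : {mfun Omega >-> CT} := HB.pack Y (isMeasurableFun.Build _ _ _ _ _ mY).
have -> : (mu A * P [set w | B (sample s w env)])%E = mscale (NngNum muA0) (distribution P Ym) B.
  by rewrite /mscale/= muAE.
have cylT : cylinders setT.
  exists fset0, (fun=> setT); split=> //; apply/seteqP; by split=> // phi _ i.
apply: (@measure_unique _ R CT cylinders (fun=> setT)) => //.
- exact: cylinders_setI.
- by rewrite bigcup_const.
- move=> _ [J [C [mC ->]]]; rewrite /= /mscale /= muAE -!/(Y @^-1` _) /pushforward /mrestr.
  rewrite -[distribution P Ym _]/(P (Y @^-1` _)).
  have [JC|] := pselect (forall i, i \in J -> i \notin s -> C i (env i)); last first.
    move=> /existsNP[i /not_implyP[iJ /not_implyP[is_ nC]]].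
    rewrite (_ : Y @^-1` _ = set0) ?set0I ?measure0 ?mule0//.
    apply/seteqP; split=> // w /(_ i iJ) /=.
    by rewrite /Y /sample (negbTE is_).
  pose J' := [fset i in J | i \in s]%fset.
  have xJ' : x \notin J' by rewrite !inE/= (negbTE xs) andbF.
  have YE : Y @^-1` (\bigcap_(i in [set` J]) [set phi | C i (phi i)]) =
      \bigcap_(i in [set` J']) X i @^-1` C i.
    apply/seteqP; split=> w h i /=.
      by rewrite !inE/= => /andP[iJ is_]; have := h i iJ; rewrite /= /Y /sample is_.
    move=> iJ; rewrite /Y /sample; case: ifPn => is_; last exact: JC.
    by have := h i; rewrite /= !inE/= iJ is_; exact.
  pose C' i := if i == x then A else C i.
  have mC' i : measurable (C' i) by rewrite /C'; case: ifP.
  have C'J i : i \in J' -> C' i = C i.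
    by move=> iJ'; rewrite /C'; case: eqP => // ix; rewrite -ix iJ' in xJ'.
  rewrite YE (_ : _ `&` _ = \bigcap_(i in [set` (x |` J')%fset]) X i @^-1` C' i); last first.
    apply/seteqP; split=> w /=.
      move=> [h hx] i /=; rewrite in_fset1U => /orP[/eqP ->|iJ'].
        by rewrite /C' eqxx.
      by rewrite C'J//; exact: h.
    move=> h; split; last by have := h x; rewrite /C' eqxx /= fset1U1; exact.
    by move=> i /= iJ'; rewrite -C'J//; apply: h; rewrite /= fset1Ur.
  rewrite X_iid.2// X_iid.2// big_fsetU1//= {1}/C' eqxx mass_eq//.
  by congr (_ * _)%E; apply: eq_big_seq => i iJ'; rewrite C'J.
- move=> k; rewrite /pushforward/= /mrestr (le_lt_trans (probability_le1 P _)) ?ltry//.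
  by apply: measurableI => //; rewrite -[_ @^-1` _]setTI; exact: (mY measurableT).
Qed.

(** The joint law of [X x] and of the remaining sample is a product measure, by [sample_independent]
    on rectangles; Tonelli then splits off one coordinate at a time. *)
Theorem expectation_iterint s (F : (I -> R) -> \bar R) env : uniq s ->
  (forall phi, 0 <= F phi)%E -> coord_measurable F ->
  (\int[P]_w F (sample s w env) = iterint mu s F env)%E.
Proof.
move=> + F0 mF; elim: s env => [|x s IH] env /=.
  move=> _; under eq_integral do rewrite (_ : sample [::] _ env = env)//.
  by rewrite integral_cst//= probability_setT mule1.
move=> /andP[xs us].
pose Y (w : Omega) : CT := sample s w env.
have mY : measurable_fun [set: Omega] Y by exact: measurable_sample.
pose XY (w : Omega) : R * CT := (X x w, Y w).
have mXY : measurable_fun [set: Omega] XY by apply: measurable_fun_pair => //; exact: measurable_funP.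
pose Ym : {mfun Omega >-> CT} := HB.pack Y (isMeasurableFun.Build _ _ _ _ _ mY).
pose XYm : {mfun Omega >-> (R * CT)%type} := HB.pack XY (isMeasurableFun.Build _ _ _ _ _ mXY).
pose H (z : R * CT) : \bar R := F (update z.2 x z.1).
have H0 z : (0 <= H z)%E by exact: F0.
have mH : measurable_fun [set: R * CT] H.
  apply: mF; apply: measurable_update; last exact: measurable_fst.
  by move=> i; apply: (measurableT_comp (measurable_coordinate i)); exact: measurable_snd.
transitivity (\int[P]_w (H \o XYm) w)%E.
  apply: eq_integral => w _; congr F; apply/funext => i.
  by rewrite /sample updateE inE /=; case: eqVneq => // ->.
rewrite -ge0_integral_distribution//.
rewrite (eq_measure_integral (mu \x distribution P Ym)%E); last first.
  move=> A mA _; apply/esym; apply: product_measure_unique => // B C mB mC.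
  by rewrite -(sample_independent env xs mB mC).
rewrite fubini_tonelli1//; apply: eq_integral => t _.
rewrite /fubini_F ge0_integral_distribution//; last first.
  exact: (measurableT_comp mH (measurable_pair1 t)).
rewrite -IH//; apply: eq_integral => w _; congr F; apply/funext => i.
rewrite /sample !updateE /=; case: eqVneq => [->|] //.
by rewrite (negbTE xs).
Qed.

End independent_expectation.

Definition lipschitz_on {R : realType} {I : eqType} (K : R) (s : seq I) (G : (I -> R) -> R) :=
  forall phi psi, `|G phi - G psi| <= K * \sum_(i <- s) `|phi i - psi i|.

(** * Variance of Lipschitz functions of independent variables *)

Section efron_stein.
Context {R : realType} (mu : probability R R) (v : R).
Hypothesis mu_sqr : (\int[mu]_t (t ^+ 2)%:E <= v%:E)%E.

Let msqr : measurable_fun [set: R] (fun t : R => (t ^+ 2)%:E).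
Proof. by apply/measurable_EFinP; exact: measurable_funX. Qed.

Let integral_prob_cst (c : R) : (\int[mu]_t c%:E = c%:E)%E.
Proof. by rewrite integral_cst//= probability_setT mule1. Qed.

Lemma integral_affine (b c k : R) : 0 <= b -> 0 <= c -> 0 <= k ->
  (\int[mu]_t (b * k + c * t ^+ 2)%:E <= (b * k + c * v)%:E)%E.
Proof.
move=> b0 c0 k0; under eq_integral do rewrite EFinD.
rewrite ge0_integralD//=.
- rewrite integral_prob_cst EFinD leeD2l//.
  under eq_integral do rewrite EFinM.
  rewrite ge0_integralZl_EFin// ?EFinM ?lee_wpmul2l ?lee_fin//.
  by move=> t _; rewrite lee_fin sqr_ge0.
- by move=> t _; rewrite lee_fin mulr_ge0.
- by move=> t _; rewrite lee_fin mulr_ge0 ?sqr_ge0.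
- by apply/measurable_EFinP; apply: measurable_funM => //; exact: measurable_funX.
Qed.

Lemma integral_lipschitz_fin (h : R -> R) (K : R) : 0 <= K -> (forall t, 0 <= h t) ->
  (forall t u, `|h t - h u| <= K * `|t - u|) -> (\int[mu]_t (h t)%:E < +oo)%E.
Proof.
move=> K0 h0 hK.
apply: (@le_lt_trans _ _ (1 * (h 0 + K) + K * v)%:E); last exact: ltry.
apply: le_trans (integral_affine _ K0 _); rewrite ?addr_ge0//.
apply: ge0_le_integralT => t; first by rewrite lee_fin.
rewrite lee_fin mul1r; have := hK t 0; rewrite subr0 ler_norml => /andP[_ h1].
have : K * `|t| <= K * (1 + t ^+ 2).
  rewrite ler_wpM2l// -(real_normK (num_real t)).
  by have := sqr_ge0 (`|t| - 1); have := normr_ge0 t; rewrite sqrrB; lra.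
by move: h1; lra.
Qed.

(** The variance is at most the mean square distance to the constant [h 0], and
    [(h t - h 0) ^+ 2 <= K ^+ 2 * t ^+ 2]. Terms are moved across the inequality so that only
    nonnegative functions are integrated. *)
Lemma variance_lipschitz (h : R -> R) (K a : R) : 0 <= K -> (forall t, 0 <= h t) ->
  measurable_fun [set: R] h ->
  (forall t u, `|h t - h u| <= K * `|t - u|) -> (\int[mu]_t (h t)%:E = a%:E)%E ->
  (\int[mu]_t (h t ^+ 2)%:E <= (a ^+ 2 + K ^+ 2 * v)%:E)%E.
Proof.
move=> K0 h0 mh hK ha.
have mEh : measurable_fun [set: R] (fun t => (h t)%:E) by exact/measurable_EFinP.
have mh2 : measurable_fun [set: R] (fun t => (h t ^+ 2)%:E).
  by apply/measurable_EFinP; exact: measurable_funX.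
have le1 : (\int[mu]_t (h t ^+ 2)%:E + (h 0 ^+ 2)%:E <=
    (K ^+ 2 * v)%:E + (2 * h 0 * a)%:E)%E.
  apply: (@le_trans _ _ (\int[mu]_t ((K ^+ 2 * t ^+ 2)%:E + (2 * h 0 * h t)%:E))%E).
    rewrite -(integral_prob_cst (h 0 ^+ 2)) -ge0_integralD//=; last 2 first.
    - by move=> t _; rewrite lee_fin sqr_ge0.
    - by move=> t _; rewrite lee_fin sqr_ge0.
    apply: ge0_le_integralT => t.
      by rewrite -EFinD lee_fin addr_ge0 ?sqr_ge0.
    rewrite -!EFinD lee_fin.
    have h1 : (h t - h 0) ^+ 2 <= (K * `|t|) ^+ 2.
      rewrite -(real_normK (num_real (h t - h 0))) ler_pXn2r ?nnegrE ?mulr_ge0//.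
      by have := hK t 0; rewrite subr0.
    rewrite exprMn (real_normK (num_real t)) in h1.
    by move: h1; rewrite sqrrB; lra.
  rewrite ge0_integralD//=; last 4 first.
  - by move=> t _; rewrite lee_fin mulr_ge0 ?sqr_ge0.
  - by apply/measurable_EFinP; apply: measurable_funM => //; exact: measurable_funX.
  - by move=> t _; rewrite lee_fin !mulr_ge0.
  - by apply/measurable_EFinP; exact: measurable_funM.
  apply: leeD.
    have := @integral_affine 0 (K ^+ 2) 0 (lexx _) (sqr_ge0 _) (lexx _).
    rewrite mul0r add0r; apply: le_trans; apply: ge0_le_integralT => t.
      by rewrite lee_fin mulr_ge0 ?sqr_ge0.
    by rewrite lee_fin add0r.
  under eq_integral do rewrite EFinM.
  rewrite ge0_integralZl_EFin ?mulr_ge0//; last by move=> t _; rewrite lee_fin.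
  by rewrite ha EFinM.
move: le1; have : (0 <= \int[mu]_t (h t ^+ 2)%:E)%E.
  by apply: integral_ge0 => t _; rewrite lee_fin sqr_ge0.
case: (\int[mu]_t (h t ^+ 2)%:E)%E => [x _| |//].
  rewrite -!EFinD !lee_fin => le1.
  by have := sqr_ge0 (a - h 0); rewrite sqrrB; move: le1; lra.
by rewrite addye// -EFinD leye_eq.
Qed.

Context {I : eqType}.
Implicit Types (s r : seq I) (G : (I -> R) -> R) (env : I -> R).

Lemma lipschitz_update (K : R) s G env x : 0 <= K -> uniq s -> lipschitz_on K s G ->
  forall t u, `|G (update env x t) - G (update env x u)| <= K * `|t - u|.
Proof.
move=> K0 us GK t u; apply: le_trans (GK _ _) _; rewrite ler_wpM2l//.
have off i : i != x -> `|update env x t i - update env x u i| = 0.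
  by move=> ix; rewrite !updateE (negbTE ix) subrr normr0.
have [xs|xs] := boolP (x \in s).
  by rewrite (bigD1_seq x)//= big1 ?addr0 ?updateE ?eqxx// => i /off.
rewrite big_seq big1 ?normr_ge0// => i is_; apply: off.
by apply: contraNneq xs => <-.
Qed.

(* Integrating out one coordinate adds at most [K ^+ 2 * v] to the variance and
   preserves the Lipschitz bound. *)
Theorem efron_stein_iterint (K : R) s r G : 0 <= K -> uniq s ->
  (forall env, 0 <= G env) -> coord_measurable (fun env => (G env)%:E) ->
  lipschitz_on K s G ->
  exists H : (I -> R) -> R, [/\ forall env, 0 <= H env, lipschitz_on K s H,
    forall env, iterint mu r (fun phi => (G phi)%:E) env = (H env)%:E &
    forall env, (iterint mu r (fun phi => (G phi ^+ 2)%:E) env <=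
      (H env ^+ 2 + K ^+ 2 * v * (size r)%:R)%:E)%E].
Proof.
move=> K0 us G0 mG GK; elim: r => [|x r [H [H0 HK HE H2]]].
  by exists G; split=> // env /=; rewrite mulr0 addr0.
have mG2 : coord_measurable (fun env => (G env ^+ 2)%:E).
  move=> d1 T g mg; apply/measurable_EFinP; apply: measurable_funX.
  exact/measurable_EFinP/mG.
have EG0 phi : (0 <= (G phi)%:E)%E by rewrite lee_fin.
have EG20 phi : (0 <= (G phi ^+ 2)%:E)%E by rewrite lee_fin sqr_ge0.
have mH env : measurable_fun [set: R] (fun t => H (update env x t)).
  have := @measurable_iterint_update _ _ _ _ mu r _ env x EG0 mG.
  by under eq_fun do rewrite HE; move/measurable_EFinP.
have Hup env := lipschitz_update env x K0 us HK.
pose H' env := fine (\int[mu]_t (H (update env x t))%:E)%E.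
have H'E env : (\int[mu]_t (H (update env x t))%:E)%E = (H' env)%:E.
  rewrite /H' fineK// ge0_fin_numE; first exact: (integral_lipschitz_fin K0 _ (Hup env)).
  by apply: integral_ge0 => t _; rewrite lee_fin.
exists H'; split.
- by move=> env; rewrite /H' fine_ge0//; apply: integral_ge0 => t _; rewrite lee_fin.
- have key phi psi : H' phi <= H' psi + K * \sum_(i <- s) `|phi i - psi i|.
    have c0 : 0 <= K * \sum_(i <- s) `|phi i - psi i| by rewrite mulr_ge0// sumr_ge0.
    rewrite -lee_fin EFinD -!H'E -(integral_prob_cst (K * _)).
    have mE : measurable_fun [set: R] (fun t => (H (update psi x t))%:E) by exact/measurable_EFinP.
    have H0' t : (0 <= (H (update psi x t))%:E)%E by rewrite lee_fin.
    have c0' : (0 <= (K * \sum_(i <- s) `|phi i - psi i|)%:E)%E by rewrite lee_fin.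
    rewrite -ge0_integralD//=.
    apply: ge0_le_integralT => t; first by rewrite lee_fin.
    rewrite -EFinD lee_fin -lerBlDl; apply: le_trans (ler_norm _) _.
    apply: le_trans (HK _ _) _; rewrite ler_wpM2l//; apply: ler_sum => i _.
    by rewrite !updateE; case: eqP => // _; rewrite subrr normr0.
  move=> phi psi; have k1 := key phi psi; have := key psi phi.
  under eq_bigr do rewrite distrC.
  by rewrite ler_norml => k2; apply/andP; split; lra.
- by move=> env /=; rewrite -H'E; apply: eq_integral => t _; rewrite HE.
- move=> env /=.
  apply: (@le_trans _ _ (\int[mu]_t ((H (update env x t) ^+ 2)%:E +
      (K ^+ 2 * v * (size r)%:R)%:E))%E).
    apply: ge0_le_integralT => t; first exact: iterint_ge0.
    by rewrite -EFinD; exact: H2.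
  have v0 : 0 <= v.
    by rewrite -lee_fin; apply: le_trans mu_sqr; apply: integral_ge0 => t _; rewrite lee_fin sqr_ge0.
  rewrite ge0_integralD//=; last 3 first.
  - by move=> t _; rewrite lee_fin sqr_ge0.
  - by apply/measurable_EFinP; exact: measurable_funX.
  - by move=> t _; rewrite lee_fin !mulr_ge0 ?sqr_ge0.
  rewrite integral_prob_cst.
  (* The new coordinate contributes [K ^+ 2 * v] on top of the bound for the coordinates in [r]. *)
  have := variance_lipschitz K0 (fun t => H0 (update env x t)) (mH env) (Hup env) (H'E env).
  move=> /(leeD2r (K ^+ 2 * v * (size r)%:R)%:E) /le_trans; apply.
  by rewrite -EFinD lee_fin -addrA -natr1 mulrDr mulr1 [X in _ + X <= _]addrC.
Qed.

End efron_stein.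

(** * Averages of environment functionals *)

Section monotone_strong_law.
Context {dO} {Omega : measurableType dO} {R : realType} (P : probability Omega R).

(** The series of the [Y n] has a finite integral, hence is finite almost everywhere, and its terms
    tend to 0. *)
Lemma ae_cvg0_summable (Y : nat -> Omega -> R) (c : R) :
  (forall n, measurable_fun [set: Omega] (Y n)) -> (forall n w, 0 <= Y n w) ->
  (forall n, \sum_(0 <= k < n) \int[P]_w (Y k w)%:E <= c%:E)%E ->
  {ae P, forall w, Y n w @[n --> \oo] --> (0 : R)}.
Proof.
move=> mY Y0 Yc.
have mEY n : measurable_fun [set: Omega] (fun w => (Y n w)%:E) by exact/measurable_EFinP.
have EY0 n w : (0 <= (Y n w)%:E)%E by rewrite lee_fin.
pose S w := (\sum_(n <oo) (Y n w)%:E)%E.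
have mS : measurable_fun [set: Omega] S by apply: ge0_emeasurable_sum.
have S0 w : (0 <= S w)%E by apply: nneseries_ge0 => n _ _; exact: EY0.
have iS : (\int[P]_w S w < +oo)%E.
  rewrite integral_nneseries//; apply: (@le_lt_trans _ _ c%:E); last exact: ltry.
  apply: lime_le; last by apply: nearW => n; exact: Yc.
  by apply: is_cvg_nneseries => n _ _; exact: integral_ge0.
have : P.-integrable [set: Omega] S.
  by apply/integrableP; split=> //; under eq_integral do rewrite gee0_abs//.
move=> /integrable_ae => /(_ measurableT); apply: filterS => w /(_ I) Sfin.
apply: cvg_series_cvg_0; apply: nondecreasing_is_cvgn.
  by apply: nondecreasing_series => n _ _.
exists (fine (S w)) => _ [n _ <-]; rewrite -lee_fin fineK// -sumEFin.
exact: nneseries_lim_ge.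
Qed.

Variables (X : nat -> Omega -> R) (N : nat -> nat) (a : nat -> R) (D c : R).
Hypothesis mX : forall n, measurable_fun [set: Omega] (X n).
Hypothesis X0 : forall n w, 0 <= X n w.
Hypothesis X_incr : forall m n w, (m <= n)%N -> X m w <= X n w.
Hypothesis N_incr : forall m n, (m <= n)%N -> (N m <= N n)%N.
Hypothesis N_unbounded : forall k, exists n, (k <= N n)%N.
Hypothesis D0 : 0 <= D.
Hypothesis EX : forall n, (\int[P]_w (X n w)%:E = (a n)%:E)%E.
Hypothesis EX2 : forall n, (\int[P]_w (X n w ^+ 2)%:E <= (a n ^+ 2 + D * (N n)%:R)%:E)%E.
Hypothesis a_lim : a n / (N n)%:R @[n --> \oo] --> c.

Let a0 n : 0 <= a n.
Proof.
by rewrite -lee_fin -EX; apply: integral_ge0 => w _; rewrite lee_fin.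
Qed.

Lemma variance_bound n : (\int[P]_w ((X n w - a n) ^+ 2)%:E <= (D * (N n)%:R)%:E)%E.
Proof.
have mEX : measurable_fun [set: Omega] (fun w => (X n w)%:E) by exact/measurable_EFinP.
have mB : measurable_fun [set: Omega] (fun w => ((X n w - a n) ^+ 2)%:E).
  by apply/measurable_EFinP; apply: measurable_funX; exact: measurable_funB.
have m2 : measurable_fun [set: Omega] (fun w => (X n w ^+ 2)%:E).
  by apply/measurable_EFinP; exact: measurable_funX.
have m1 : measurable_fun [set: Omega] (fun w => (2 * a n * X n w)%:E).
  by apply/measurable_EFinP; exact: measurable_funM.
have EX0 w : setT w -> (0 <= (X n w)%:E)%E by rewrite lee_fin.
have B0 w : setT w -> (0 <= ((X n w - a n) ^+ 2)%:E)%E by rewrite lee_fin sqr_ge0.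
have s0 w : setT w -> (0 <= (X n w ^+ 2)%:E)%E by rewrite lee_fin sqr_ge0.
have l0 w : setT w -> (0 <= (2 * a n * X n w)%:E)%E by rewrite lee_fin !mulr_ge0.
have c0 (w : Omega) : setT w -> (0 <= (a n ^+ 2)%:E)%E by rewrite lee_fin sqr_ge0.
(* The expanded square, arranged so that no extended reals are subtracted. *)
have : (\int[P]_w ((X n w - a n) ^+ 2)%:E + (2 * a n * a n)%:E =
    \int[P]_w (X n w ^+ 2)%:E + (a n ^+ 2)%:E)%E.
  transitivity (\int[P]_w (((X n w - a n) ^+ 2)%:E + (2 * a n * X n w)%:E))%E.
    rewrite ge0_integralD//; congr (_ + _)%E.
    under eq_integral do rewrite EFinM.
    by rewrite ge0_integralZl_EFin ?mulr_ge0// EX EFinM.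
  transitivity (\int[P]_w ((X n w ^+ 2)%:E + (a n ^+ 2)%:E))%E.
    by apply: eq_integral => w _; rewrite -!EFinD; congr EFin; ring.
  by rewrite ge0_integralD// integral_cst//= probability_setT mule1.
have := EX2 n; case: (\int[P]_w (X n w ^+ 2)%:E)%E => [x| |].
- rewrite lee_fin => h1; have := integral_ge0 P B0.
  case: (\int[P]_w ((X n w - a n) ^+ 2)%:E)%E => [y _| |//].
    by rewrite -!EFinD => -[]; rewrite lee_fin; move: h1; lra.
  by rewrite addye.
- by rewrite leye_eq.
- move=> _; have := integral_ge0 P B0.
  by case: (\int[P]_w ((X n w - a n) ^+ 2)%:E)%E.
Qed.

(* Along any sequence of indices with [N (u k) >= (k + 1)^2] the variances of the
   averages are summable. *)
Lemma ae_cvg_subsequence (u : nat -> nat) : (forall k, (k.+1 ^ 2 <= N (u k))%N) ->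
  (forall n, \forall k \near \oo, (n <= u k)%N) ->
  {ae P, forall w, X (u k) w / (N (u k))%:R @[k --> \oo] --> c}.
Proof.
move=> Nu u_lim.
have Nu0 k : 0 < (N (u k))%:R :> R by rewrite ltr0n (leq_trans _ (Nu k))// expn_gt0.
pose Y k w := ((X (u k) w - a (u k)) / (N (u k))%:R) ^+ 2.
have mY k : measurable_fun [set: Omega] (Y k).
  by apply: measurable_funX; apply: measurable_funM => //; exact: measurable_funB.
have IY k : (\int[P]_w (Y k w)%:E <= (D / (k.+1%:R ^+ 2))%:E)%E.
  apply: (@le_trans _ _ (((N (u k))%:R ^- 2)%:E * (D * (N (u k))%:R)%:E)%E).
    rewrite -[leLHS]/(integral _ _ _).
    under eq_integral do rewrite /Y exprMn exprVn mulrC EFinM.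
    rewrite ge0_integralZl_EFin ?invr_ge0 ?sqr_ge0//; last 2 first.
    - by move=> w _; rewrite lee_fin sqr_ge0.
    - by apply/measurable_EFinP; apply: measurable_funX; exact: measurable_funB.
    by rewrite lee_wpmul2l ?variance_bound// lee_fin invr_ge0 sqr_ge0.
  rewrite -EFinM lee_fin.
  have -> : (N (u k))%:R ^- 2 * (D * (N (u k))%:R) = D / (N (u k))%:R.
    by field; rewrite gt_eqF.
  rewrite ler_wpM2l// lef_pV2 ?posrE// ?exprn_gt0//.
  by rewrite -natrX ler_nat.
have sumY n : (\sum_(0 <= k < n) \int[P]_w (Y k w)%:E <= (2 * D)%:E)%E.
  apply: (@le_trans _ _ (\sum_(0 <= k < n) (D / (k.+1%:R ^+ 2))%:E)%E).
    by apply: lee_sum => k _; exact: IY.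
  rewrite sumEFin lee_fin.
  (* Telescoping bound: the first [n] inverse squares sum to at most [2 - 1 / n]; for [n = 0] the
     quotient is 0 by convention. *)
  apply: (@le_trans _ _ (2 * D - D / n%:R)); last by rewrite gerBl divr_ge0.
  case: n => [|n]; first by rewrite big_nil invr0 mulr0 subr0 mulr_ge0.
  elim: n => [|n IH]; first by rewrite big_nat1 expr1n !divr1; lra.
  rewrite big_nat_recr//=; apply: le_trans (lerD IH (lexx _)) _.
  rewrite -addrA lerD2l -subr_ge0.
  have -> : - (D / n.+2%:R) - (- (D / n.+1%:R) + D / n.+2%:R ^+ 2) =
      D / (n.+1%:R * n.+2%:R ^+ 2).
    have n1 : n.+1%:R != 0 :> R by [].
    have n2 : n.+1%:R + 1 != 0 :> R by rewrite natr1.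
    by rewrite -(natr1 n.+1); field; apply/andP.
  by rewrite divr_ge0// mulr_ge0// sqr_ge0.
apply: filterS (ae_cvg0_summable mY (fun k w => sqr_ge0 _) sumY) => w Yw.
have au : a (u k) / (N (u k))%:R @[k --> \oo] --> c.
  apply: cvg_comp a_lim => A [m _ mA].
  by near=> k; apply: mA => /=; near: k; exact: u_lim.
have dev : (X (u k) w - a (u k)) / (N (u k))%:R @[k --> \oo] --> (0 : R).
  apply/norm_cvg0P.
  have : Num.sqrt (Y k w) @[k --> \oo] --> Num.sqrt (0 : R).
    exact: (continuous_cvg _ (@sqrt_continuous R 0) Yw).
  by rewrite sqrtr0; under eq_fun do rewrite sqrtr_sqr.
rewrite (_ : (fun k => X (u k) w / _) =
    (fun k => (X (u k) w - a (u k)) / (N (u k))%:R + a (u k) / (N (u k))%:R)).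
  by rewrite -[c]add0r; exact: cvgD.
by apply/funext => k; rewrite -mulrDl subrK.
Unshelve. all: by end_near. Qed.

Let first_index k := ex_minn (N_unbounded (k.+1 ^ 2)).

Let first_indexP k : (k.+1 ^ 2 <= N (first_index k))%N /\
  forall n, (k.+1 ^ 2 <= N n)%N -> (first_index k <= n)%N.
Proof. by rewrite /first_index; case: ex_minnP. Qed.

(** The index just before the next block starts. If [N] jumps over block [k], that index may precede
    [first_index k]; the maximum keeps [N] at least [(k + 1)^2]. *)
Let last_index k := maxn (first_index k) (first_index k.+1).-1.

Let last_indexP k : (k.+1 ^ 2 <= N (last_index k))%N.
Proof.
by apply: leq_trans (first_indexP k).1 _; apply: N_incr; exact: leq_maxl.
Qed.

Let first_index_lim n : \forall k \near \oo, (n <= first_index k)%N.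
Proof.
exists (N n).+1 => // k /= nk; rewrite leqNgt; apply/negP => kn.
have := leq_trans (first_indexP k).1 (N_incr (ltnW kn)).
rewrite leqNgt => /negP; apply; apply: leq_trans nk _.
by rewrite (leq_trans (leqnSn k))// -mulnn leq_pmulr.
Qed.

Let last_index_lim n : \forall k \near \oo, (n <= last_index k)%N.
Proof.
by apply: filterS (first_index_lim n) => k /leq_trans; apply; exact: leq_maxl.
Qed.

Let block_ex n : exists k, (N n < k.+2 ^ 2)%N.
Proof.
by exists (N n); rewrite (@leq_trans (N n).+2)// -mulnn leq_pmulr.
Qed.

Let block n := ex_minn (block_ex n).

Let blockP n : (N n < (block n).+2 ^ 2)%N /\ ((0 < N n)%N -> ((block n).+1 ^ 2 <= N n)%N).
Proof.
rewrite /block; case: ex_minnP => k kn kmin; split=> // n0; rewrite leqNgt.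
case: k kn kmin => [|k] kn kmin; first by rewrite -leqNgt exp1n.
by apply/negP => /kmin; rewrite ltnn.
Qed.

Let block_lim k : \forall n \near \oo, (k <= block n)%N.
Proof.
have [m mk] := N_unbounded (k.+1 ^ 2); exists m => // n /= mn.
rewrite leqNgt; apply/negP => nk; have := (blockP n).1.
rewrite ltnNge => /negP; apply; apply: leq_trans (N_incr mn); apply: leq_trans mk.
by rewrite leq_exp2r.
Qed.

(* [X n] is squeezed between its values at the first and the last index of the
   block [(k + 1)^2 <= N n < (k + 2)^2]. *)
Theorem monotone_strong_law :
  {ae P, forall w, X n w / (N n)%:R @[n --> \oo] --> c}.
Proof.
have h1 := ae_cvg_subsequence (fun k => (first_indexP k).1) first_index_lim.
have h2 := ae_cvg_subsequence last_indexP last_index_lim.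
apply: filterS2 h1 h2 => w h1 h2.
(* A lower bound for the ratio of two values of [N] within block [k]; it tends to 1, so changing the
   denominator inside a block costs nothing in the limit. *)
pose r k : R := (k.+1%:R / k.+2%:R) ^+ 2.
have r_gt0 k : 0 < r k by rewrite exprn_gt0.
have r_lim : r k @[k --> \oo] --> (1 : R).
  have h : k.+1%:R / k.+2%:R @[k --> \oo] --> (1 : R).
    rewrite (_ : (fun k => _) = (fun k => 1 - k.+2%:R^-1)); last first.
      apply/funext => k; have n2 : k.+1%:R + 1 != 0 :> R by rewrite natr1.
      by rewrite -(natr1 k.+1); field.
    rewrite -[X in _ --> X]subr0; apply: cvgB; first exact: cvg_cst.
    by rewrite (cvg_shiftS (@harmonic R)); exact: cvg_harmonic.
  by rewrite -(expr1n _ 2); apply: (continuous_cvg _ (@exprn_continuous R 2 1) h).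
have lo : X (first_index (block n)) w / (N (first_index (block n)))%:R * r (block n)
    @[n --> \oo] --> c.
  rewrite -[c]mulr1.
  apply: (cvg_comp block (fun k => X (first_index k) w / (N (first_index k))%:R * r k)
    (G := \oo)); last exact: cvgM.
  by move=> A [k _ kA]; near=> n; apply: kA => /=; near: n; exact: block_lim.
have hi : X (last_index (block n)) w / (N (last_index (block n)))%:R / r (block n)
    @[n --> \oo] --> c.
  rewrite -[c]divr1.
  apply: (cvg_comp block (fun k => X (last_index k) w / (N (last_index k))%:R / r k)
    (G := \oo)); last by apply: cvgM => //; apply: cvgV => //; exact: oner_neq0.
  by move=> A [k _ kA]; near=> n; apply: kA => /=; near: n; exact: block_lim.
apply: (squeeze_cvgr _ lo hi).
have [n1 n1P] := N_unbounded 1.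
near=> n.
have Nn : (0 < N n)%N.
  by apply: leq_trans n1P _; apply: N_incr; near: n; exists n1.
have [bn1 /(_ Nn) bn2] := blockP n; set k := block n in bn1 bn2 *.
have [fk1 fk2] := first_indexP k.
have [gk1 gk2] := first_indexP k.+1.
have fkn : (first_index k <= n)%N by exact: fk2.
have ngk : (n < first_index k.+1)%N.
  by rewrite ltnNge; apply/negP => /N_incr /(leq_trans gk1); rewrite leqNgt bn1.
have nl : (n <= last_index k)%N.
  by rewrite leq_max; apply/orP; right; rewrite -ltnS prednK// (leq_ltn_trans _ ngk).
(* Block [k] contains [n], hence is not skipped, and its last index lies before
   [first_index k.+1]. *)
have Nl : (N (last_index k) < k.+2 ^ 2)%N.
  rewrite ltnNge; apply/negP => /gk2; apply/negP; rewrite -ltnNge gtn_max.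
  by rewrite (leq_ltn_trans fkn ngk)/= prednK// (leq_ltn_trans _ ngk).
have NR m : (k.+1 ^ 2 <= N m)%N -> 0 < (N m)%:R :> R.
  by move=> km; rewrite ltr0n (leq_trans _ km)// expn_gt0.
have key m m' : (k.+1 ^ 2 <= N m)%N -> (k.+1 ^ 2 <= N m')%N -> (N m' < k.+2 ^ 2)%N ->
    X m w / (N m)%:R * r k <= X m w / (N m')%:R.
  move=> km km' m'k; rewrite -mulrA ler_wpM2l// /r expr_div_n ler_pdivrMl ?NR//.
  rewrite ler_pdivrMr ?exprn_gt0// mulrAC ler_pdivlMr ?NR//.
  by rewrite -!natrX -!natrM ler_nat; exact: leq_mul km (ltnW m'k).
apply/andP; split.
  apply: le_trans (key _ n fk1 bn2 bn1) _.
  by rewrite ler_wpM2r ?invr_ge0// X_incr.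
rewrite ler_pdivlMr//; apply: le_trans (key n (last_index k) bn2 (last_indexP k) Nl) _.
by rewrite ler_wpM2r ?invr_ge0// X_incr.
Unshelve. all: by end_near. Qed.

End monotone_strong_law.

Section exhausting.
Context {d : nat}.
Hypothesis d0 : (0 < d)%N.
Variable L : nat -> {fset site d}.
Hypothesis L_exh : exhausting_sequence L.

Lemma exhausting_mono m n : (m <= n)%N -> (L m `<=` L n)%fset.
Proof.
move=> mn; rewrite -(subnK mn); elim: (n - m)%N => [|k IH]; first exact: fsubset_refl.
by rewrite addSn; exact: fsubset_trans IH (L_exh.1 _).
Qed.

Lemma exhausting_card_unbounded k : exists n, (k <= #|` L n|)%N.
Proof.
pose i0 : 'I_d := Ordinal d0; pose p (j : nat) : site d := j%:R *: basis_vec i0.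
have pinj : injective p.
  move=> i j /matrixP/(_ 0 i0)/eqP; rewrite !mxE !eqxx !mulr1 eqr_nat => /eqP.
  exact.
have [n np] : exists n, forall j, (j < k)%N -> p j \in L n.
  elim: k => [|k [n IH]]; first by exists 0%N.
  have [m pm] := L_exh.2 (p k); exists (maxn m n) => j; rewrite ltnS leq_eqVlt.
  move=> /predU1P[->|/IH pj]; first exact: (fsubsetP (exhausting_mono (leq_maxl m n))).
  exact: (fsubsetP (exhausting_mono (leq_maxr m n))).
exists n; rewrite -(size_iota 0 k) -(size_map p).
apply: uniq_leq_size; first by rewrite map_inj_uniq ?iota_uniq.
by move=> _ /mapP[j + ->]; rewrite mem_iota add0n => /np.
Qed.

End exhausting.

Lemma sqr_add_le {R : realDomainType} (x y : R) : (x + y) ^+ 2 <= 2 * x ^+ 2 + 2 * y ^+ 2.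
Proof. by have := sqr_ge0 (x - y); rewrite sqrrB sqrrD; lra. Qed.

Section environment_average.
Context {dO} {Omega : measurableType dO} {R : realType} (P : probability Omega R).
Context {d : nat}.
Hypothesis d0 : (0 < d)%N.
Variables (e : site d -> {RV P >-> R}) (v K C : R).
Hypothesis e_iid : iid e.
Hypothesis e_sqr : forall x, (\int[P]_w (e x w ^+ 2)%:E <= v%:E)%E.
Variable M : {fset site d} -> (site d -> R) -> R.
Hypotheses (K0 : 0 <= K) (C0 : 0 <= C).
Hypothesis M0 : forall V, M fset0 V = 0.
Hypothesis M_incr : forall V (A : {fset site d}) x, x \notin A -> M A V <= M (x |` A)%fset V.
Hypothesis M_super : forall V (A B : {fset site d}) x, (A `<=` B)%fset -> x \notin B ->
  M (x |` A)%fset V - M A V <= M (x |` B)%fset V - M B V.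
Hypothesis M_lip : forall A : {fset site d}, lipschitz_on K A (M A).
Hypothesis M_le : forall A : {fset site d}, M A (fun=> 0) <= C * #|` A|%:R.
Hypothesis M_shift : forall V (A : {fset site d}) (z : site d),
  M [fset (x + z)%R | x in A]%fset V = M A (fun x => V (x + z)).
Hypothesis mM : forall A : {fset site d}, coord_measurable (fun V : site d -> R => (M A V)%:E).
Implicit Types (A B : {fset site d}).

Let mu := distribution P (e 0).
Let env w : site d -> R := fun x => e x w.

Lemma functional_mono V A B : (A `<=` B)%fset -> M A V <= M B V.
Proof.
move=> AB; have -> : B = ((B `\` A) `|` A)%fset.
  apply/fsetP => x; rewrite !inE; case xA: (x \in A); last by rewrite orbF.
  by rewrite (fsubsetP AB).
move: (B `\` A)%fset => D.
elim/(@lex_max_ind d): D => [|x D xD _ IH]; first by rewrite fset0U.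
rewrite -fsetUA; have [xA|xA] := boolP (x \in (D `|` A)%fset).
  by rewrite mem_fset1U.
exact: le_trans IH (M_incr _ xA).
Qed.

Lemma functional_ge0 A V : 0 <= M A V.
Proof. by rewrite -(M0 V) functional_mono ?fsub0set. Qed.

Let EM0 A w : (0 <= (M A (env w))%:E)%E. Proof. by rewrite lee_fin functional_ge0. Qed.

Let m_env x : measurable_fun [set: Omega] (fun w => env w x). Proof. exact: measurable_funP. Qed.

Let mMenv A : measurable_fun [set: Omega] (fun w => M A (env w)).
Proof. by apply/measurable_EFinP; exact: (@mM A _ Omega env m_env). Qed.

(** Locality is a consequence of the Lipschitz bound, whose sum runs over [A] only. *)
Lemma functional_local A V V' : {in A, V =1 V'} -> M A V = M A V'.
Proof.
move=> VV'; apply/eqP; rewrite -subr_eq0 -normr_le0; apply: le_trans (M_lip _ _ _) _.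
by rewrite big_seq big1 ?mulr0// => x /VV' ->; rewrite subrr normr0.
Qed.

Let mu_sqr : (\int[mu]_t (t ^+ 2)%:E <= v%:E)%E.
Proof.
rewrite ge0_integral_distribution//=.
  by apply/measurable_EFinP; exact: measurable_funX.
by move=> t; rewrite lee_fin sqr_ge0.
Qed.

(** The second equation expresses the mean through the one-site law alone; translation invariance of
    the mean is read off from it. *)
Lemma functional_moments A : exists a : R,
  [/\ (\int[P]_w (M A (env w))%:E = a%:E)%E,
      iterint mu A (fun V => (M A V)%:E) (fun=> 0) = a%:E &
      (\int[P]_w (M A (env w) ^+ 2)%:E <= (a ^+ 2 + K ^+ 2 * v * #|` A|%:R)%:E)%E].
Proof.
have [H [H0 HK HE H2]] := efron_stein_iterint mu_sqr A K0 (fset_uniq A)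
  (functional_ge0 A) (@mM A) (@M_lip A).
have sampleE w : M A (sample e A w (fun=> 0)) = M A (env w).
  by apply: functional_local => x xA; rewrite /sample xA.
have F0 V : (0 <= (M A V)%:E)%E by rewrite lee_fin functional_ge0.
have F20 V : (0 <= (M A V ^+ 2)%:E)%E by rewrite lee_fin sqr_ge0.
have mF2 : coord_measurable (fun V : site d -> R => (M A V ^+ 2)%:E).
  move=> d1 T g mg; apply/measurable_EFinP; apply: measurable_funX.
  by apply/measurable_EFinP; exact: (@mM A).
have E1 := expectation_iterint e_iid 0 (fun=> 0) (fset_uniq A) F0 (@mM A).
have E2 := expectation_iterint e_iid 0 (fun=> 0) (fset_uniq A) F20 mF2.
exists (H (fun=> 0)); split.
- by rewrite -HE -[RHS]E1; apply: eq_integral => w _; rewrite sampleE.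
- exact: HE.
- apply: le_trans (H2 _); rewrite -[leRHS]E2.
  by apply: ge0_le_integralT => w; rewrite ?lee_fin ?sqr_ge0// sampleE.
Qed.

Let mean A : R := fine (\int[P]_w (M A (env w))%:E)%E.

Let meanE A : (\int[P]_w (M A (env w))%:E = (mean A)%:E)%E.
Proof. by rewrite /mean; have [a [-> _ _]] := functional_moments A. Qed.

Lemma functional_sqr A :
  (\int[P]_w (M A (env w) ^+ 2)%:E <= (mean A ^+ 2 + K ^+ 2 * v * #|` A|%:R)%:E)%E.
Proof. by rewrite /mean; have [a [-> _ h]] := functional_moments A. Qed.

Let mean_shift A (z : site d) : mean [fset (x + z)%R | x in A]%fset = mean A.
Proof.
set Az := [fset _ | _ in _]%fset.
have [a [-> + _]] : exists a : R, [/\ mean Az = a,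
    iterint mu Az (fun V => (M Az V)%:E) (fun=> 0) = a%:E & True].
  by rewrite /mean; have [a [-> h _]] := functional_moments Az; exists a.
have [b [-> + _]] : exists a : R, [/\ mean A = a,
    iterint mu A (fun V => (M A V)%:E) (fun=> 0) = a%:E & True].
  by rewrite /mean; have [b [-> h _]] := functional_moments A; exists b.
move=> bE; rewrite (@perm_iterint _ _ _ _ _ Az [seq x + z | x <- A]); last first.
- exact: (@mM _).
- by move=> V; rewrite lee_fin functional_ge0.
- apply: uniq_perm; first exact: fset_uniq.
    by rewrite map_inj_uniq ?fset_uniq//; exact: addIr.
  by move=> y; apply/imfsetP/mapP => -[x xA ->]; exists x.
- exact: fset_uniq.
pose Phi (psi : site d -> R) : site d -> R := fun x => psi (x - z).
have PhiE psi x t : x \in enum_fset A -> Phi (update psi x t) = update (Phi psi) (x + z) t.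
  by move=> _; apply/funext => y; rewrite /Phi !updateE subr_eq.
rewrite -[fun=> 0]/(Phi (fun=> 0)) (iterint_map mu _ PhiE).
have -> : iterint mu A ((fun V => (M Az V)%:E) \o Phi) (fun=> 0) =
    iterint mu A (fun V => (M A V)%:E) (fun=> 0).
  apply: eq_iterint_off => V _ /=; rewrite M_shift; congr EFin.
  by apply: functional_local => x _; rewrite /Phi addrK.
by rewrite bE => -[].
Qed.

Let integral_prob_cst (c : R) : (\int[P]_w c%:E = c%:E)%E.
Proof. by rewrite integral_cst//= probability_setT mule1. Qed.

(** Lipschitz comparison with the zero environment, and [|e x w| <= 1 + e x w ^+ 2] to pass to
    second moments. *)
Let mean_le A : mean A <= (C + K * (1 + v)) * #|` A|%:R.
Proof.
rewrite -lee_fin -meanE.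
have mabs x : measurable_fun [set: Omega] (fun w => (1 + e x w ^+ 2)%:E).
  by apply/measurable_EFinP; apply: measurable_funD => //; exact: measurable_funX.
have abs0 x w : setT w -> (0 <= (1 + e x w ^+ 2)%:E)%E by rewrite lee_fin addr_ge0 ?sqr_ge0.
apply: (@le_trans _ _ (\int[P]_w ((C * #|` A|%:R)%:E +
    K%:E * \sum_(x <- A) (1 + e x w ^+ 2)%:E))%E).
  apply: ge0_le_integralT => w; first exact: EM0.
  rewrite sumEFin -EFinM -EFinD lee_fin.
  have := @M_lip A (env w) (fun=> 0); rewrite ler_norml => /andP[_ h].
  apply: (@le_trans _ _ (M A (fun=> 0) + K * \sum_(i <- A) `|env w i - 0|)).
    by rewrite -lerBlDl.
  apply: lerD => //; rewrite ler_wpM2l//; apply: ler_sum => x _.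
  rewrite subr0 /env -(real_normK (num_real (e x w))).
  by have := sqr_ge0 (`|e x w| - 1); have := normr_ge0 (e x w); rewrite sqrrB; lra.
have ms : measurable_fun [set: Omega] (fun w => \sum_(x <- A) (1 + e x w ^+ 2)%:E)%E.
  exact: emeasurable_sum.
have s0 w : setT w -> (0 <= \sum_(x <- A) (1 + e x w ^+ 2)%:E)%E.
  by move=> _; apply: sume_ge0 => x _; exact: abs0.
have c0 (w : Omega) : setT w -> (0 <= (C * #|` A|%:R)%:E)%E by rewrite lee_fin mulr_ge0.
have K0E : (0 <= K%:E)%E by rewrite lee_fin.
have mKs : measurable_fun [set: Omega] (fun w => K%:E * \sum_(x <- A) (1 + e x w ^+ 2)%:E)%E.
  exact: measurable_funeM.
have Ks0 w : setT w -> (0 <= K%:E * \sum_(x <- A) (1 + e x w ^+ 2)%:E)%E.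
  by move=> Tw; rewrite mule_ge0// s0.
have msq x : measurable_fun [set: Omega] (fun w => (e x w ^+ 2)%:E).
  by apply/measurable_EFinP; exact: measurable_funX.
have sq0 x w : setT w -> (0 <= (e x w ^+ 2)%:E)%E by rewrite lee_fin sqr_ge0.
rewrite ge0_integralD// integral_prob_cst ge0_integralZl//.
rewrite ge0_integral_sum// mulrDl EFinD leeD2l// -mulrA EFinM lee_wpmul2l//.
apply: (@le_trans _ _ (\sum_(x <- A) (1 + v)%:E)%E).
  apply: lee_sum => x _; under eq_integral do rewrite EFinD.
  rewrite ge0_integralD//; last exact: sq0.
  by rewrite integral_prob_cst EFinD leeD2l.
by rewrite sumEFin big_const_seq count_predT iter_addr_0 mulr_natr.
Qed.

Lemma functional_sqr_fin A : exists x : R, (\int[P]_w (M A (fun x => e x w) ^+ 2)%:E <= x%:E)%E.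
Proof. by have [a [_ _ h]] := functional_moments A; exists (a ^+ 2 + K ^+ 2 * v * #|` A|%:R). Qed.

Lemma measurable_functional A : measurable_fun [set: Omega] (fun w => M A (fun x => e x w)).
Proof. exact: mMenv. Qed.

Theorem environment_average : exists c : R, forall L : nat -> {fset site d},
  exhausting_sequence L -> vanishing_boundary R L ->
  {ae P, forall w, M (L n) (fun x => e x w) / #|` L n|%:R @[n --> \oo] --> c} /\
  exists2 r : nat -> R, r n @[n --> \oo] --> 0 & \forall n \near \oo,
    (\int[P]_w ((M (L n) (fun x => e x w) / #|` L n|%:R - c) ^+ 2)%:E <= (r n)%:E)%E.
Proof.
have mean0 : mean fset0 = 0.
  rewrite /mean (eq_integral (cst 0%E)) ?integral0// => w _.
  by rewrite M0.
have mean_incr (A : {fset site d}) x : x \notin A -> mean A <= mean (x |` A)%fset.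
  move=> xA; rewrite -lee_fin -!meanE; apply: ge0_le_integralT => w //.
  by rewrite lee_fin M_incr.
have mean_super (A B : {fset site d}) x : (A `<=` B)%fset -> x \notin B ->
    mean (x |` A)%fset - mean A <= mean (x |` B)%fset - mean B.
  move=> AB xB; rewrite lerBrDr addrAC lerBlDr -lee_fin !EFinD -!meanE.
  have mE A' : measurable_fun [set: Omega] (fun w => (M A' (env w))%:E) by exact/measurable_EFinP.
  rewrite -!ge0_integralD//; apply: ge0_le_integralT => w; first exact: adde_ge0.
  rewrite -!EFinD lee_fin.
  by have := M_super (env w) AB xB; lra.
have [c cP] := supermodular_limit mean0 mean_incr mean_super mean_shift mean_le.
exists c => L Lexh Lvan.
have N_unb := exhausting_card_unbounded d0 Lexh.
have N_incr m n : (m <= n)%N -> (#|` L m| <= #|` L n|)%N.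
  by move=> mn; apply: fsubset_leq_card; exact: exhausting_mono.
have Npos : \forall n \near \oo, (0 < #|` L n|)%N.
  have [n n1] := N_unb 1%N; exists n => // m /= nm.
  exact: leq_trans n1 (N_incr _ _ nm).
have v0 : 0 <= v.
  rewrite -lee_fin; apply: le_trans (e_sqr 0).
  by apply: integral_ge0 => w _; rewrite lee_fin sqr_ge0.
have D0 : 0 <= K ^+ 2 * v by rewrite mulr_ge0 ?sqr_ge0.
have a_lim := cP L Lvan Npos.
have X_incr m n w : (m <= n)%N -> M (L m) (env w) <= M (L n) (env w).
  by move=> mn; apply: functional_mono; exact: exhausting_mono.
have mX n := mMenv (L n).
have X0 n w := functional_ge0 (L n) (env w).
have EX n := meanE (L n); have EX2 n := functional_sqr (L n).
split; first exact: (monotone_strong_law mX X0 X_incr N_incr N_unb D0 EX EX2 a_lim).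
have var n := variance_bound mX X0 EX EX2 n.
pose N n : R := #|` L n|%:R.
(* Twice the variance of the average, at most [K ^+ 2 * v / N n], plus twice the squared distance
   from the averaged mean to [c]. *)
pose b n := 2 * (K ^+ 2 * v) / N n + 2 * (mean (L n) / N n - c) ^+ 2.
have b_lim : b n @[n --> \oo] --> (0 : R).
  have inv_lim : (N n)^-1 @[n --> \oo] --> (0 : R).
    apply/gtr0_cvgV0; first by near do rewrite ltr0n; exact: Npos.
    apply/cvgryPge => A; have [k kA] : exists k : nat, A <= k%:R.
      by exists (Num.truncn A).+1; exact: ltW (truncnS_gt _).
    have [n kn] := N_unb k; exists n => // m /= nm.
    by apply: le_trans kA _; rewrite ler_nat; exact: leq_trans kn (N_incr _ _ nm).
  have -> : 0 = 2 * (K ^+ 2 * v) * 0 + 2 * (c - c) ^+ 2 :> R by rewrite subrr expr0n !mulr0 addr0.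
  apply: cvgD; first by apply: cvgM => //; exact: cvg_cst.
  apply: cvgM; first exact: cvg_cst.
  have dl : (mean (L n) / N n - c) @[n --> \oo] --> c - c.
    by apply: cvgB; [exact: a_lim|exact: cvg_cst].
  exact: (continuous_cvg _ (@exprn_continuous R 2 (c - c)) dl).
exists b => //; near=> n.
have N0 : 0 < N n by rewrite ltr0n; near: n.
have mB : measurable_fun [set: Omega] (fun w => ((M (L n) (env w) - mean (L n)) ^+ 2)%:E).
  by apply/measurable_EFinP; apply: measurable_funX; exact: measurable_funB.
have B0 w : setT w -> (0 <= ((M (L n) (env w) - mean (L n)) ^+ 2)%:E)%E.
  by rewrite lee_fin sqr_ge0.
have k0 : 0 <= 2 / N n ^+ 2 by rewrite divr_ge0 ?sqr_ge0.
apply: (@le_trans _ _ (\int[P]_w ((2 / N n ^+ 2)%:E *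
    ((M (L n) (env w) - mean (L n)) ^+ 2)%:E +
    (2 * (mean (L n) / N n - c) ^+ 2)%:E))%E).
  apply: ge0_le_integralT => w; first by rewrite lee_fin sqr_ge0.
  rewrite -EFinM -EFinD lee_fin.
  have -> : M (L n) (env w) / N n - c =
    (M (L n) (env w) - mean (L n)) / N n + (mean (L n) / N n - c).
    by field; rewrite gt_eqF.
  have -> : 2 / N n ^+ 2 * (M (L n) (env w) - mean (L n)) ^+ 2 =
    2 * ((M (L n) (env w) - mean (L n)) / N n) ^+ 2 by field; rewrite gt_eqF.
  exact: sqr_add_le.
rewrite ge0_integralD//; first last.
- by move=> w _; rewrite lee_fin mulr_ge0 ?sqr_ge0.
- by apply: measurable_funeM.
- by move=> w _; rewrite mule_ge0 ?B0 ?lee_fin.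
rewrite integral_prob_cst ge0_integralZl_EFin// /b EFinD leeD2r//.
apply: le_trans (lee_wpmul2l _ (var n)) _; first by rewrite lee_fin.
rewrite -EFinM lee_fin le_eqVlt; apply/orP; left; apply/eqP.
by rewrite -/(N n); field; rewrite gt_eqF.
Unshelve. all: by end_near. Qed.

End environment_average.

(** * The quenched free energy *)

Section square_integrable.
Context {dO} {Omega : measurableType dO} {R : realType} (P : probability Omega R).
Implicit Types f g : Omega -> R.

Lemma Lnorm2E f : ('N[P]_(2%:E)[(fun w => (f w)%:E)] = sqrte (\int[P]_w (f w ^+ 2)%:E))%E.
Proof.
rewrite Lnorm.unlock -poweR12_sqrt; last first.
  by apply: integral_ge0 => w _; rewrite lee_fin sqr_ge0.
congr (_ `^ _)%E; apply: eq_integral => w _.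
by rewrite /= (powR_mulrn 2) ?normr_ge0// real_normK ?num_real.
Qed.

Lemma Lfun2_sqr f : measurable_fun [set: Omega] f ->
  (\int[P]_w (f w ^+ 2)%:E < +oo)%E -> f \in Lfun P 2%:E.
Proof.
move=> mf f2; rewrite inE; apply/andP; split; rewrite inE//=.
rewrite /finite_norm -[EFin \o f]/(fun w => (f w)%:E) Lnorm2E.
by move: f2; case: (\int[P]_w _)%E => //= x _; exact: ltry.
Qed.

Lemma integral_sqr_add_le f g (x y : R) :
  measurable_fun [set: Omega] f -> measurable_fun [set: Omega] g ->
  (\int[P]_w (f w ^+ 2)%:E <= x%:E)%E -> (\int[P]_w (g w ^+ 2)%:E <= y%:E)%E ->
  (\int[P]_w ((f w + g w) ^+ 2)%:E <= (2 * x + 2 * y)%:E)%E.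
Proof.
move=> mf mg fx gy.
have m2 (k : Omega -> R) : measurable_fun [set: Omega] k ->
    measurable_fun [set: Omega] (fun w => (k w ^+ 2)%:E).
  by move=> mk; apply/measurable_EFinP; exact: measurable_funX.
have s0 (k : Omega -> R) w : setT w -> (0 <= (k w ^+ 2)%:E)%E by rewrite lee_fin sqr_ge0.
have t0 : (0 <= 2%:E :> \bar R)%E by rewrite lee_fin.
have mm (k : Omega -> R) : measurable_fun [set: Omega] k ->
    measurable_fun [set: Omega] (fun w => 2%:E * (k w ^+ 2)%:E)%E.
  by move=> mk; apply: measurable_funeM; exact: m2.
have ms0 (k : Omega -> R) w : setT w -> (0 <= 2%:E * (k w ^+ 2)%:E)%E.
  by move=> Tw; rewrite mule_ge0// s0.
apply: (@le_trans _ _ (\int[P]_w (2%:E * (f w ^+ 2)%:E + 2%:E * (g w ^+ 2)%:E))%E).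
  apply: ge0_le_integralT => w; first by rewrite lee_fin sqr_ge0.
  by rewrite -!EFinM -EFinD lee_fin sqr_add_le.
rewrite (ge0_integralD P measurableT (ms0 f) (mm _ mf) (ms0 g) (mm _ mg)).
rewrite (ge0_integralZl P measurableT (m2 _ mf) (s0 f) t0).
rewrite (ge0_integralZl P measurableT (m2 _ mg) (s0 g) t0).
by rewrite (EFinD (2 * x)) !(EFinM 2); apply: leeD; rewrite lee_wpmul2l.
Qed.

End square_integrable.

Theorem theorem2p1 (R : realType) (dO : measure_display)
    (Omega : measurableType dO) (P : probability Omega R)
    (d : nat) (hd : (2 <= d)%N) (a b h : R) (ha : 0 < a) (hb : 0 < b)
    (e : site d -> {RV P >-> R}) (e_iid : iid e)
    (e_mean : forall x, ('E_P[e x] = 0)%E)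
    (e_var : forall x, ('V_P[e x] = 1)%E)
    (e_exp : forall x, ('E_P[fun w => expR (b * e x w + h)] < +oo)%E) :
  exists fq : (site d -> R) -> R,
    let f (w : Omega) : R := fq (fun x => e x w) in
    let f_ (L : {fset site d}) (w : Omega) : R :=
      quenched_free_energy a b h L (fun x => e x w) in
    [/\ f \in Lfun P 2%:E,
        forall L : nat -> {fset site d},
          exhausting_sequence L -> vanishing_boundary R L ->
          [/\ {ae P, forall w, f_ (L n) w @[n --> \oo] --> f w},
              forall n, f_ (L n) \in Lfun P 2%:E &
              ('N[P]_(2%:E)[(fun w => (f_ (L n) w - f w)%:E)] @[n --> \oo]
                 --> 0)%E] &
        {ae P, forall w, (f w)%:E = ('E_P[f])%E}].
Proof.
have d0 : (0 < d)%N by exact: leq_trans hd.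
(* Since the mean vanishes, the variance is the second moment. *)
have e_sqr x : (\int[P]_w (e x w ^+ 2)%:E <= 1%:E)%E.
  have := e_var x; rewrite /variance covariance.unlock e_mean /= expectation.unlock => <-.
  rewrite le_eqVlt; apply/orP; left; apply/eqP; apply: eq_integral => w _.
  by rewrite /GRing.mul /= subr0 expr2.
pose V (env : site d -> R) (x : site d) : R := b * env x + h.
have V_lip env env' x : `|V env x - V env' x| = b * `|env x - env' x|.
  by rewrite /V opprD addrACA subrr addr0 -mulrBr normrM gtr0_norm.
have mV d1 (T : measurableType d1) (g : T -> site d -> R) :
    (forall x, measurable_fun [set: T] (g ^~ x)) ->
    forall x, measurable_fun [set: T] (fun u => V (g u) x).
  by move=> mg x; apply: measurable_funD => //; apply: measurable_funM => //; exact: mg.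
have [C C0 CP] := log_partition_free_le d0 a.
(* The free energy is [(M1 - M2 - M3) / |L|]: [M2] removes the random correction [|V x|] contained
   in [M1], and the constants [ln gauss_mass] cancel between [M1] and [M3]. [M2] is additive over
   sites and [M3] does not depend on the environment (Lipschitz constant 0), so all three satisfy
   the hypotheses of [environment_average]. *)
pose M1 (L : {fset site d}) env := log_partition a (V env) L.
pose M2 (L : {fset site d}) env : R := \sum_(x <- L) `|V env x|.
pose M3 (L : {fset site d}) (env : site d -> R) := log_partition a (fun=> 0) L.
pose conv (M : {fset site d} -> (site d -> R) -> R) (c : R) :=
  forall L : nat -> {fset site d}, exhausting_sequence L -> vanishing_boundary R L ->
  {ae P, forall w, M (L n) (fun x => e x w) / #|` L n|%:R @[n --> \oo] --> c} /\
  exists2 r : nat -> R, r n @[n --> \oo] --> 0 & \forall n \near \oo,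
    (\int[P]_w ((M (L n) (fun x => e x w) / #|` L n|%:R - c) ^+ 2)%:E <= (r n)%:E)%E.
pose sqi (M : {fset site d} -> (site d -> R) -> R) := forall L : {fset site d},
  measurable_fun [set: Omega] (fun w => M L (fun x => e x w)) /\
  exists x : R, (\int[P]_w (M L (fun x => e x w) ^+ 2)%:E <= x%:E)%E.
have sum_const (L : {fset site d}) (k : R) : \sum_(x <- L) k = k * #|` L|%:R.
  by rewrite big_const_seq count_predT iter_addr_0 mulr_natr.
have b2 : 0 <= 2 * b by rewrite mulr_ge0// ltW.
have M1_lip (L : {fset site d}) : lipschitz_on (2 * b) L (M1 L).
  move=> env env'; apply: le_trans (log_partition_lipschitz d0 a _ _ L) _.
  by rewrite -mulrA ler_wpM2l// mulr_sumr ler_sum// => x _; rewrite V_lip.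
have M1_le (L : {fset site d}) : M1 L (fun=> 0) <= (C + 2 * `|h|) * #|` L|%:R.
  have := log_partition_lipschitz d0 a (V (fun=> 0)) (fun=> 0) L.
  rewrite ler_norml => /andP[_]; rewrite lerBlDl => /le_trans; apply.
  rewrite [leRHS]mulrDl; apply: lerD; first exact: CP.
  rewrite -mulrA ler_wpM2l// -sum_const; apply: ler_sum => x _.
  by rewrite subr0 /V mulr0 add0r.
have M1_meas (L : {fset site d}) : coord_measurable (fun env : site d -> R => (M1 L env)%:E).
  by move=> d1 T g /mV mg; exact: (@coord_measurable_log_partition _ _ d0 a L _ _ _ mg).
have C1 : 0 <= C + 2 * `|h| by rewrite addr_ge0// mulr_ge0.
have M1_incr env (A : {fset site d}) x : x \notin A -> M1 A env <= M1 (x |` A)%fset env.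
  exact: log_partition_incr.
have M1_super env (A B : {fset site d}) x : (A `<=` B)%fset -> x \notin B ->
    M1 (x |` A)%fset env - M1 A env <= M1 (x |` B)%fset env - M1 B env.
  exact: log_partition_supermodular.
have M1_shift env (A : {fset site d}) (z : site d) :
    M1 [fset (x + z)%R | x in A]%fset env = M1 A (fun x => env (x + z)).
  exact: log_partition_shift.
have M10 env : M1 fset0 env = 0 by exact: log_partition0.
have M2_lip (L : {fset site d}) : lipschitz_on b L (M2 L).
  move=> env env'; rewrite /M2 -sumrB mulr_sumr; apply: le_trans (ler_norm_sum _ _ _) _.
  by apply: ler_sum => x _; rewrite -V_lip ler_dist_dist.
have M2_le (L : {fset site d}) : M2 L (fun=> 0) <= `|h| * #|` L|%:R.
  by rewrite -sum_const ler_sum// => x _; rewrite /V mulr0 add0r.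
have M2_meas (L : {fset site d}) : coord_measurable (fun env : site d -> R => (M2 L env)%:E).
  move=> d1 T g /mV mg; apply/measurable_EFinP; apply: measurable_sum => x.
  exact: (measurableT_comp (@normr_measurable R setT) (mg x)).
have M2_incr env (A : {fset site d}) x : x \notin A -> M2 A env <= M2 (x |` A)%fset env.
  by move=> xA; rewrite /M2 big_fsetU1//= lerDr.
have M2_super env (A B : {fset site d}) x : (A `<=` B)%fset -> x \notin B ->
    M2 (x |` A)%fset env - M2 A env <= M2 (x |` B)%fset env - M2 B env.
  move=> AB xB; have xA : x \notin A by apply: contra xB => /(fsubsetP AB).
  by rewrite /M2 !big_fsetU1//= !addrK.
have M2_shift env (A : {fset site d}) (z : site d) :
    M2 [fset (x + z)%R | x in A]%fset env = M2 A (fun x => env (x + z)).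
  by rewrite /M2 big_imfset//= => x y _ _ /addIr.
have M20 env : M2 fset0 env = 0 by rewrite /M2 big_seq_fset0.
have M3_lip (L : {fset site d}) : lipschitz_on 0 L (M3 L).
  by move=> env env'; rewrite subrr normr0 mul0r.
have M3_meas (L : {fset site d}) : coord_measurable (fun env : site d -> R => (M3 L env)%:E).
  by move=> d1 T g _; rewrite /M3; exact: measurable_cst.
have M3_incr (env : site d -> R) (A : {fset site d}) x : x \notin A ->
    M3 A env <= M3 (x |` A)%fset env.
  exact: log_partition_incr.
have M3_super (env : site d -> R) (A B : {fset site d}) x : (A `<=` B)%fset -> x \notin B ->
    M3 (x |` A)%fset env - M3 A env <= M3 (x |` B)%fset env - M3 B env.
  exact: log_partition_supermodular.
have M3_shift (env : site d -> R) (A : {fset site d}) (z : site d) :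
    M3 [fset (x + z)%R | x in A]%fset env = M3 A (fun x => env (x + z)).
  exact: log_partition_shift.
have M30 (env : site d -> R) : M3 fset0 env = 0 by exact: log_partition0.
have [c1 conv1] : exists c, conv M1 c.
  exact: (environment_average d0 e_iid e_sqr b2 C1 M10 M1_incr M1_super M1_lip M1_le
    M1_shift M1_meas).
have [c2 conv2] : exists c, conv M2 c.
  exact: (environment_average d0 e_iid e_sqr (ltW hb) (normr_ge0 h) M20 M2_incr M2_super
    M2_lip M2_le M2_shift M2_meas).
have [c3 conv3] : exists c, conv M3 c.
  exact: (environment_average d0 e_iid e_sqr (lexx 0) C0 M30 M3_incr M3_super M3_lip CP
    M3_shift M3_meas).
have sqi1 : sqi M1.
  move=> L; split; first exact: measurable_functional.
  exact: (functional_sqr_fin e_iid e_sqr b2 M10 M1_incr M1_lip M1_meas).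
have sqi2 : sqi M2.
  move=> L; split; first exact: measurable_functional.
  exact: (functional_sqr_fin e_iid e_sqr (ltW hb) M20 M2_incr M2_lip M2_meas).
have sqi3 : sqi M3.
  move=> L; split; first exact: measurable_functional.
  exact: (functional_sqr_fin e_iid e_sqr (lexx 0) M30 M3_incr M3_lip M3_meas).
have fE (L : {fset site d}) env : quenched_free_energy a b h L env =
    #|` L|%:R^-1 * (M1 L env - M2 L env - M3 L env).
  rewrite /quenched_free_energy.
  rewrite -[partition_function L (pinning_potential _ _ _ _ _)]/(pinned_partition a (V env) L).
  have -> : partition_function L (fun=> 0) = pinned_partition a (fun=> 0) L.
    congr partition_function; apply/funext => phi.
    by rewrite big1// => x _; rewrite mul0r.
  rewrite -!/(realZ a _ L) ln_div ?posrE ?realZ_gt0//; congr (_ * _).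
  rewrite /M1 /M2 /M3 /log_partition normr0 sub0r big_split/=; ring.
(* The limit is a constant function of the environment, so it equals its expectation everywhere. *)
exists (fun=> c1 - c2 - c3) => f f_.
have f_cst : f = cst (c1 - c2 - c3) by [].
split; first by rewrite f_cst; exact: Lfun_cst.
- move=> L Lexh Lvan.
  have [a1 [r1 r1_lim r1P]] := conv1 L Lexh Lvan.
  have [a2 [r2 r2_lim r2P]] := conv2 L Lexh Lvan.
  have [a3 [r3 r3_lim r3P]] := conv3 L Lexh Lvan.
  have f_E n w : f_ (L n) w = M1 (L n) (fun x => e x w) / #|` L n|%:R -
      M2 (L n) (fun x => e x w) / #|` L n|%:R - M3 (L n) (fun x => e x w) / #|` L n|%:R.
    by rewrite /f_ fE mulrC !mulrBl.
  split.
  + apply: filterS3 a1 a2 a3 => w a1 a2 a3.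
    rewrite (funext (fun n => f_E n w)).
    exact: cvgB (cvgB a1 a2) a3.
  + move=> n.
    have [[m1 [x1 q1]] [m2 [x2 q2]] [m3 [x3 q3]]] := And3 (sqi1 (L n)) (sqi2 (L n)) (sqi3 (L n)).
    have qN (M : Omega -> R) x : (\int[P]_w (M w ^+ 2)%:E <= x%:E)%E ->
        (\int[P]_w ((- M w) ^+ 2)%:E <= x%:E)%E by under [in X in _ -> X]eq_integral do rewrite sqrrN.
    have mN (M : Omega -> R) : measurable_fun [set: Omega] M ->
        measurable_fun [set: Omega] (fun w => - M w).
      by move=> mM; exact: (measurableT_comp (@oppr_measurable R setT) mM).
    have m12 := measurable_funD m1 (mN _ m2).
    have q123 := integral_sqr_add_le m12 (mN _ m3)
      (integral_sqr_add_le m1 (mN _ m2) q1 (qN _ _ q2)) (qN _ _ q3).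
    have l123 := Lfun2_sqr (measurable_funD m12 (mN _ m3)) (le_lt_trans q123 (ltry _)).
    have -> : f_ (L n) = #|` L n|%:R^-1 \o* (fun w => M1 (L n) (fun x => e x w) +
        - M2 (L n) (fun x => e x w) + - M3 (L n) (fun x => e x w)).
      by apply/funext => w; rewrite /f_ fE mulrC.
    by apply: Lfun_scale => //; rewrite ler1n.
  + have mq M n (c : R) : sqi M ->
        measurable_fun [set: Omega] (fun w => M (L n) (fun x => e x w) / #|` L n|%:R - c).
      by move=> sM; apply: measurable_funB => //; apply: measurable_funM => //; exact: (sM _).1.
    (* The coefficients come from applying [(x + y) ^+ 2 <= 2 * x ^+ 2 + 2 * y ^+ 2] twice to the
       three errors. *)
    pose r n := 2 * (2 * r1 n + 2 * r2 n) + 2 * r3 n.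
    have r_lim : r n @[n --> \oo] --> (0 : R).
      have -> : 0 = 2 * (2 * 0 + 2 * 0) + 2 * 0 :> R by ring.
      apply: cvgD; last by apply: cvgM => //; exact: cvg_cst.
      apply: cvgM; first exact: cvg_cst.
      by apply: cvgD; apply: cvgM => //; exact: cvg_cst.
    have sqrt_lim : (Num.sqrt (r n))%:E @[n --> \oo] --> (0%E : \bar R).
      apply/fine_cvgP; split; first exact: nearW.
      by rewrite /= -[X in _ --> X]sqrtr0; exact: (continuous_cvg _ (@sqrt_continuous R 0) r_lim).
    apply: (squeeze_cvge _ (cvg_cst 0%E) sqrt_lim).
    near=> n; rewrite Lnorm_ge0/= Lnorm2E.
    have r1n : (\int[P]_w ((M1 (L n) (fun x => e x w) / #|` L n|%:R - c1) ^+ 2)%:E <= (r1 n)%:E)%E.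
      by near: n.
    have r2n : (\int[P]_w ((c2 - M2 (L n) (fun x => e x w) / #|` L n|%:R) ^+ 2)%:E <= (r2 n)%:E)%E.
      have : (\int[P]_w ((M2 (L n) (fun x => e x w) / #|` L n|%:R - c2) ^+ 2)%:E <= (r2 n)%:E)%E.
        by near: n.
      by under eq_integral do rewrite -sqrrN opprB.
    have r3n : (\int[P]_w ((c3 - M3 (L n) (fun x => e x w) / #|` L n|%:R) ^+ 2)%:E <= (r3 n)%:E)%E.
      have : (\int[P]_w ((M3 (L n) (fun x => e x w) / #|` L n|%:R - c3) ^+ 2)%:E <= (r3 n)%:E)%E.
        by near: n.
      by under eq_integral do rewrite -sqrrN opprB.
    have mq' M (c : R) : sqi M ->
        measurable_fun [set: Omega] (fun w => c - M (L n) (fun x => e x w) / #|` L n|%:R).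
      by move=> sM; apply: measurable_funB => //; apply: measurable_funM => //; exact: (sM _).1.
    have m12 := measurable_funD (mq _ n c1 sqi1) (mq' _ c2 sqi2).
    have rn := integral_sqr_add_le m12 (mq' _ c3 sqi3)
      (integral_sqr_add_le (mq _ n c1 sqi1) (mq' _ c2 sqi2) r1n r2n) r3n.
    have rn0 : (0 <= (r n)%:E)%E.
      by apply: le_trans rn; apply: integral_ge0 => w _; rewrite lee_fin sqr_ge0.
    rewrite -[(Num.sqrt _)%:E]/(sqrte (r n)%:E) lee_sqrt//.
    apply: le_trans rn; rewrite le_eqVlt; apply/orP; left; apply/eqP.
    by apply: eq_integral => w _; rewrite f_E /f; congr (_ ^+ 2)%:E => /=; ring.
- have fE1 w : (f w)%:E = ('E_P[f])%E by rewrite f_cst expectation_cst.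
  exact: (aeW P fE1).
Unshelve. all: by end_near. Qed.
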